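(* Let $\mathcal{Z} = (Z_i)_{i \in \mathbb{N}}$ be a (real-valued) Gaussian process such that $\mathrm{cov}(Z_i,Z_j) \leq 0$ for all distinct $i,j \in \mathbb{N}$. Then $\mathcal{Z}$ has a trivial tail $\sigma$-field: $\mathbb{P}(E) \in \{0,1\}$ for every $E \in \bigcap_{n=1}^\infty \sigma(Z_i : i \geq n)$.
   Context: A Gaussian process $(Z_i)_{i\in\mathbb{N}}$ is a sequence of random variables all of whose finite subfamilies are jointly Gaussian. *)

(* Defs.v *)
From HB Require Import structures.
From mathcomp Require Import all_boot all_order all_algebra.
From mathcomp Require Import all_classical all_reals all_analysis.

Set Implicit Arguments.
Unset Strict Implicit.
Unset Printing Implicit Defensive.
Import Order.TTheory GRing.Theory Num.Theory.
Import numFieldNormedType.Exports.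
Local Open Scope classical_set_scope.
Local Open Scope ring_scope.

(* Gaussian law with mean m and standard deviation s. The case s = 0 is split
   off because the library's [normal_prob m 0] is the uniform law on [0, 1],
   not the point mass at m. *)
Definition gaussian_law (R : realType) (m s : R) (A : set R) : \bar R :=
  if s == 0 then \d_m A else normal_prob m s A.

(* The laws are compared on Borel sets only: a measure is a total function on
   sets, with unspecified values outside the sigma-algebra. *)
Definition is_gaussian (d : measure_display) (T : measurableType d)
    (R : realType) (P : probability T R) (X : T -> R) : Prop :=
  exists m s : R, 0 <= s /\
    forall A : set R, measurable A -> P (X @^-1` A) = gaussian_law m s A.

(* Every linear combination is Gaussian, degenerate laws included. *)
Definition jointly_gaussian (d : measure_display) (T : measurableType d)
    (R : realType) (P : probability T R) (n : nat)
    (X : 'I_n -> {RV P >-> R}) : Prop :=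
  forall c : 'I_n -> R, is_gaussian P (fun t => \sum_(i < n) c i * X i t).

Definition gaussian_process (d : measure_display) (T : measurableType d)
    (R : realType) (P : probability T R) (Z : nat -> {RV P >-> R}) : Prop :=
  forall (n : nat) (k : 'I_n -> nat), injective k ->
    jointly_gaussian (fun i => Z (k i)).

Definition tail_sigma_algebra (d : measure_display) (T : measurableType d)
    (R : realType) (P : probability T R) (Z : nat -> {RV P >-> R}) :
    set (set T) :=
  \bigcap_(n : nat)
    <<s \bigcup_(i in [set i : nat | (n <= i)%N])
          g_sigma_algebra_preimage (Z i) >>.

(* Main.v *)
(* Let v_i be the centred Z_i, seen in L^2(P). As the angles between the v_i are
   obtuse, sums of K vectors of norm at most 1 taken in cones on disjoint blocks
   of the v_i have norm at most sqrt K; hence a fixed vector g cannot have scalar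
   product at least e > 0 with each of them. Splitting a combination into
   its positive and negative parts, which also make an obtuse angle, shows that
   the projection p_n of g on the span of the v_i, i >= n, tends to 0.

   On the side of events, indicators of events in sigma(Z_i : i >= n) are limits in
   L^2 of trigonometric polynomials q in the Z_i, i >= n, and the formula
   E cos X = cos (E X) exp (- Var X / 2) gives E[q cos g] = c E[q cos p_n], where
   c = exp (- Var (g - p_n) / 2) also relates E[cos g] to E[cos p_n]. Hence the
   covariance of q and cos g is at most that of q and cos p_n, which tends to 0 with
   Var p_n. A tail event is thus uncorrelated with all the trigonometric
   polynomials, therefore with itself. *)
Require Import Defs.
From HB Require Import structures.
From mathcomp Require Import all_boot all_order all_algebra.
From mathcomp Require Import all_classical all_reals all_analysis.
From mathcomp Require Import measurable_realfun.
From mathcomp Require Import ring lra.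

Set Implicit Arguments.
Unset Strict Implicit.
Unset Printing Implicit Defensive.
Import Order.TTheory GRing.Theory Num.Theory.
Import numFieldNormedType.Exports.
Local Open Scope classical_set_scope.
Local Open Scope ring_scope.

(** * Gaussian laws *)

(** The measure is given by the density [normal_pdf m s], so its Radon-Nikodym derivative agrees
    with this density almost everywhere, and the general change of variables applies. *)
Lemma ge0_integral_normal_prob (R : realType) (m s : R) (f : R -> \bar R) :
  measurable_fun setT f -> (forall x, 0 <= f x)%E ->
  (\int[normal_prob m s]_x f x =
   \int[lebesgue_measure]_x (f x * (normal_pdf m s x)%:E))%E.
Proof.
move=> mf f0.
have dom := normal_prob_dominates m s.
rewrite -(Radon_Nikodym_SigmaFinite.change_of_variables dom)//.
apply: ae_eq_integral => //.
- apply: emeasurable_funM => //; apply: measurable_int.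
  exact: Radon_Nikodym_SigmaFinite.f_integrable.
- by apply: emeasurable_funM => //; apply/measurable_EFinP; exact: measurable_normal_pdf.
apply: ae_eqe_mul2l; apply: integral_ae_eq => //.
- exact: Radon_Nikodym_SigmaFinite.f_integrable.
- by apply/measurable_EFinP; exact: measurable_normal_pdf.
- by move=> E _ mE; rewrite -(Radon_Nikodym_SigmaFinite.f_integral dom).
Qed.

Section gaussian_transfer.
Context d (T : measurableType d) (R : realType) (P : probability T R).
Variables (X : T -> R) (m s : R).
Hypothesis mX : measurable_fun setT X.
Hypothesis lawX : forall A : set R, measurable A -> P (X @^-1` A) = normal_prob m s A.

Lemma ge0_integral_gaussian (f : R -> \bar R) :
  measurable_fun setT f -> (forall x, 0 <= f x)%E ->
  (\int[P]_x f (X x) =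
   \int[lebesgue_measure]_x (f x * (normal_pdf m s x)%:E))%E.
Proof.
move=> mf f0; rewrite -ge0_integral_normal_prob//.
have mX' : @measurable_fun _ _ T (measurableTypeR R) setT X by exact: mX.
pose Y : {mfun T >-> measurableTypeR R} :=
  @mfun_Sub _ _ T (measurableTypeR R) X (mem_set mX').
rewrite -[LHS](@ge0_integral_distribution _ _ _ _ _ P Y)//.
apply: (eq_measure_integral (normal_prob m s)) => A mA _.
exact: lawX.
Qed.

Lemma integrable_gaussian (f : R -> R) : measurable_fun setT f ->
  lebesgue_measure.-integrable setT (fun x => (f x * normal_pdf m s x)%:E) ->
  P.-integrable setT (fun x => (f (X x))%:E).
Proof.
move=> mf /integrableP[_ fi]; apply/integrableP; split.
  by apply/measurable_EFinP; exact: measurableT_comp.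
rewrite (ge0_integral_gaussian (f := fun x => `|(f x)%:E|%E))//; last first.
  by apply: measurableT_comp => //; apply/measurable_EFinP.
apply: le_lt_trans fi; apply: ge0_le_integral => //=.
- by move=> x _; rewrite lee_fin mulr_ge0// normal_pdf_ge0.
- apply/measurable_EFinP; apply: measurable_funM.
    exact: measurableT_comp.
  exact: measurable_normal_pdf.
- apply/measurable_EFinP; apply: measurableT_comp => //; apply: measurable_funM => //.
  exact: measurable_normal_pdf.
- by move=> x _; rewrite lee_fin normrM (ger0_norm (normal_pdf_ge0 _ _ _)).
Qed.

(** Reduction to positive and negative parts, which commute with the product by the nonnegative
    density. *)
Lemma integral_gaussian (f : R -> R) : measurable_fun setT f ->
  lebesgue_measure.-integrable setT (fun x => (f x * normal_pdf m s x)%:E) ->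
  (\int[P]_x (f (X x))%:E =
   \int[lebesgue_measure]_x (f x * normal_pdf m s x)%:E)%E.
Proof.
move=> mf fi.
have mfe : measurable_fun setT (EFin \o f) by apply/measurable_EFinP.
rewrite [LHS]integralE [RHS]integralE.
congr (_ - _)%E.
- transitivity (\int[P]_x ((EFin \o f)^\+ (X x)))%E.
    by apply: eq_integral => x _; rewrite !unlock.
  rewrite ge0_integral_gaussian//; last exact: measurable_funepos.
  apply: eq_integral => x _; rewrite !unlock /= EFinM.
  by rewrite maxe_pMl ?lee_fin ?normal_pdf_ge0// mul0e.
- transitivity (\int[P]_x ((EFin \o f)^\- (X x)))%E.
    by apply: eq_integral => x _; rewrite !unlock.
  rewrite ge0_integral_gaussian//; last exact: measurable_funeneg.
  apply: eq_integral => x _; rewrite !unlock /=.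
  by rewrite maxe_pMl ?lee_fin ?normal_pdf_ge0// mul0e -EFinM mulNr.
Qed.

End gaussian_transfer.

(** * Stein's identity for the normal density *)

Section normal_stein.
Context (R : realType) (m s : R).
Hypothesis s0 : s != 0.
Local Notation mu := (@lebesgue_measure R).
Local Notation p := (normal_pdf m s).

Let s2_gt0 : 0 < s ^+ 2. Proof. by rewrite exprn_even_gt0. Qed.

Let c_gt0 : 0 < 4 * s ^+ 2. Proof. by rewrite pmulr_rgt0. Qed.

(** With [u = (x - m)^2 / (4 s^2)] this is [u exp (-2u) <= exp (-u)], that is [u <= exp u]: doubling
    the variance absorbs a quadratic factor. *)
Lemma sqr_normal_fun_le (x : R) :
  (x - m) ^+ 2 * normal_fun m s x <=
  (4 * s ^+ 2) * normal_fun m (Num.sqrt 2 * s) x.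
Proof.
rewrite /normal_fun exprMn sqr_sqrtr//.
set u := (x - m) ^+ 2 / (4 * s ^+ 2).
have -> : - (x - m) ^+ 2 / (s ^+ 2 *+ 2) = - u - u.
  by rewrite /u -mulr_natl; field.
have -> : - (x - m) ^+ 2 / (2 * s ^+ 2 *+ 2) = - u.
  by rewrite /u -mulr_natl; field.
have -> : (x - m) ^+ 2 = 4 * s ^+ 2 * u by rewrite /u; field.
have u0 : 0 <= u by rewrite divr_ge0 ?sqr_ge0// ltW.
rewrite -mulrA ler_pM2l // expRD mulrA ler_piMl ?expR_ge0//.
rewrite expRN ler_pdivrMr ?expR_gt0// mul1r.
by apply: le_trans (expR_ge1Dx _); rewrite lerDr.
Qed.

Lemma integrable_normal_quadratic (f : R -> R) (A : R) :
  measurable_fun setT f -> (forall x, `|f x| <= A * (1 + (x - m) ^+ 2)) ->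
  mu.-integrable setT (fun x => (f x * p x)%:E).
Proof.
move=> mf fA.
have A0 : 0 <= A.
  have := le_trans (normr_ge0 _) (fA m).
  by rewrite subrr expr0n/= addr0 mulr1.
pose s' := Num.sqrt 2 * s.
have s'0 : s' != 0 by rewrite mulf_neq0// gt_eqF// sqrtr_gt0.
(* The bound on the unnormalised bells, corrected by the ratio of the peaks, dominates the quadratic
   term by a multiple of the density of deviation [s']. *)
pose K := normal_peak s * (4 * s ^+ 2) / normal_peak s'.
have : mu.-integrable setT
    (fun x => (A%:E * ((p x)%:E + K%:E * (normal_pdf m s' x)%:E))%E).
  apply: integrableZl => //; apply: integrableD => //.
    exact: integrable_normal_pdf.
  by apply: integrableZl => //; exact: integrable_normal_pdf.
apply: le_integrable => //.
  apply/measurable_EFinP; apply: measurable_funM => //.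
  exact: measurable_normal_pdf.
move=> x _; rewrite /= lee_fin.
rewrite normrM (ger0_norm (normal_pdf_ge0 _ _ _)).
apply: le_trans (ler_norm _).
apply: (@le_trans _ _ (A * (1 + (x - m) ^+ 2) * p x)).
  by rewrite ler_wpM2r ?normal_pdf_ge0.
rewrite -mulrA ler_wpM2l// mulrDl mul1r lerD2l.
rewrite !normal_pdfE// /K [leRHS]mulrA divfK ?gt_eqF ?normal_peak_gt0//.
rewrite mulrCA -[leRHS]mulrA ler_wpM2l ?normal_peak_ge0//.
exact: sqr_normal_fun_le.
Qed.

Lemma is_derive_normal_pdf (x : R) :
  is_derive x 1 (p : R -> R) (- ((x - m) / s ^+ 2) * p x).
Proof.
rewrite normal_pdfE// /normal_fun.
have H : is_derive x 1 (fun x : R => - (x - m) ^+ 2 / (s ^+ 2 *+ 2)) (- (x - m) / s ^+ 2).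
  apply: is_derive_eq.
  rewrite /GRing.scale/= -mulr_natl; field.
  exact: s0.
apply: is_derive_eq.
by rewrite /GRing.scale/= mulNr; ring.
Qed.

(** Quadratic decay is what makes the boundary terms of an integration by parts vanish for [f] of
    linear growth. *)
Lemma normal_pdf_decay : exists2 K, 0 <= K &
  forall x, (1 + (x - m) ^+ 2) * p x <= K.
Proof.
exists (normal_peak s * (1 + 4 * s ^+ 2)).
  by rewrite mulr_ge0 ?normal_peak_ge0// addr_ge0// ltW.
move=> x; rewrite normal_pdfE// mulrCA ler_wpM2l ?normal_peak_ge0//.
have le1 t : normal_fun m t x <= 1.
  rewrite -[leRHS]expR0 ler_expR mulNr oppr_le0 mulr_ge0// ?sqr_ge0//.
  by rewrite invr_ge0 mulrn_wge0// sqr_ge0.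
rewrite mulrDl mul1r lerD//.
apply: le_trans (sqr_normal_fun_le _) _.
by rewrite ler_piMr// ltW.
Qed.

(** Integration by parts: [G = f p] has derivative [g = f' p - (x - m) f p / s^2], and the integral
    of [g] over the line is 0 because [G] vanishes at infinity. *)
Lemma normal_stein (f f' : R -> R) (A : R) :
  (forall x : R, is_derive x 1 f (f' x)) -> continuous f' ->
  (forall x, `|f x| <= A * (1 + `|x - m|)) -> (forall x, `|f' x| <= A) ->
  \int[mu]_x ((x - m) * f x * p x) = s ^+ 2 * \int[mu]_x (f' x * p x).
Proof.
move=> df cf' fA f'A.
have A0 : 0 <= A by exact: le_trans (normr_ge0 _) (f'A m).
have cf : continuous f.
  by move=> x; apply: differentiable_continuous; apply/derivable1_diffP; case: (df x).
have cp := continuous_normal_pdf (m := m) s0.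
have mf := continuous_measurable_fun cf.
have mf' := continuous_measurable_fun cf'.
have mxm : measurable_fun setT (fun x : R => x - m).
  by apply: measurable_funB => //; exact: measurable_id.
have i1 : mu.-integrable setT (fun x => (f' x * p x)%:E).
  apply: (@integrable_normal_quadratic _ A) => // x.
  by apply: le_trans (f'A x) _; rewrite ler_peMr// lerDl sqr_ge0.
have i2 : mu.-integrable setT (fun x => (((x - m) * f x) * p x)%:E).
  apply: (@integrable_normal_quadratic _ (2 * A)) => [|x].
    exact: measurable_funM.
  rewrite normrM; apply: le_trans (ler_wpM2l (normr_ge0 _) (fA x)) _.
  rewrite mulrCA -[leRHS]mulrA [leRHS]mulrCA ler_wpM2l//.
  rewrite -[(x - m) ^+ 2]real_normK ?num_real//.
  by have := normr_ge0 (x - m); nra.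
pose G x := f x * p x.
pose g x := f' x * p x - (s ^+ 2)^-1 * ((x - m) * f x * p x).
have dG (x : R) : is_derive x 1 (G : R -> R) (g x).
  have := is_derive_normal_pdf x => dp.
  apply: is_derive_eq; rewrite /GRing.scale/= /g; field.
  exact: s0.
have cg : continuous g.
  move=> x; apply: cvgB; first by apply: cvgM; [exact: cf'|exact: cp].
  apply: cvgM; first exact: cvg_cst.
  apply: cvgM; last exact: cp.
  apply: cvgM; last exact: cf.
  by apply: cvgB; [exact: cvg_id|exact: cvg_cst].
have i3 : mu.-integrable setT
    (fun x => ((s ^+ 2)^-1 * ((x - m) * f x * p x))%:E).
  by under eq_fun do rewrite EFinM; exact: integrableZl.
have ig : mu.-integrable setT (EFin \o g).
  by rewrite /g /comp; under eq_fun do rewrite EFinB; exact: integrableB.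
suff : \int[mu]_x g x = 0.
  rewrite /g RintegralB//.
  rewrite RintegralZl// => /eqP; rewrite subr_eq0 => /eqP ->.
  by rewrite mulrA divff ?mul1r// gt_eqF.
have [K K0 GK] := normal_pdf_decay.
have Gle x : `|x - m| * `|G x| <= 2 * A * K.
  rewrite /G normrM (ger0_norm (normal_pdf_ge0 _ _ _)) mulrA.
  apply: (@le_trans _ _ (2 * A * ((1 + (x - m) ^+ 2) * p x))); last first.
    by rewrite ler_wpM2l// mulr_ge0.
  rewrite mulrA ler_wpM2r ?normal_pdf_ge0//.
  apply: le_trans (ler_wpM2l (normr_ge0 _) (fA x)) _.
  rewrite mulrCA -[leRHS]mulrA [leRHS]mulrCA ler_wpM2l//.
  rewrite -[(x - m) ^+ 2]real_normK ?num_real//.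
  by have := normr_ge0 (x - m); nra.
pose J n := `[m - n.+1%:R, m + n.+1%:R]%classic.
have JE n : (\int[mu]_(x in J n) (g x)%:E)%E =
    (G (m + n.+1%:R) - G (m - n.+1%:R))%:E.
  rewrite EFinB; apply: (@continuous_FTC2 _ g G).
  - by rewrite ltrD2l; apply: (@lt_trans _ _ 0); rewrite ?oppr_lt0 ltr0n.
  - exact: continuous_subspaceT.
  - have cG : continuous G.
      by move=> x; apply: differentiable_continuous; apply/derivable1_diffP; case: (dG x).
    split.
    + by move=> x _; case: (dG x).
    + exact: cvg_at_right_filter (cG _).
    + exact: cvg_at_left_filter (cG _).
  - by move=> x _; rewrite derive1E; apply: derive_val.
(* The integrals over the growing intervals [J n] have two limits: the full integral, by dominated
   convergence, and 0, by the fundamental theorem of calculus. *)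
have lim1 : (\int[mu]_(x in J n) (g x)%:E)%E @[n --> \oo] --> (\int[mu]_x (g x)%:E)%E.
  under eq_cvg do rewrite integral_mkcond.
  apply: (@dominated_cvg _ _ _ mu _ measurableT _ _ (fun x => `|(g x)%:E|%E)) => //.
  - move=> n; apply/(measurable_restrictT _ _).1.
      exact: measurable_itv.
    apply: measurable_funTS; apply/measurable_EFinP.
    exact: continuous_measurable_fun.
  - move=> x _; apply: cvg_near_cst.
    exists (Num.truncn `|x - m|) => // n /= xn.
    rewrite patchE mem_set// /J /= in_itv/=.
    have : `|x - m| <= n.+1%:R.
      apply: ltW; apply: (lt_le_trans (truncnS_gt _)).
      by rewrite ler_nat.
    by rewrite ler_norml lerBlDl lerBrDl => /andP[-> ->].
  - exact: integrable_abse.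
  - by move=> n x _; rewrite patchE; case: ifPn => // _; rewrite abse0.
have lim2 : (\int[mu]_(x in J n) (g x)%:E)%E @[n --> \oo] --> 0%:E.
  under eq_cvg do rewrite JE.
  apply: cvg_EFin; first exact: nearW.
  apply/norm_cvg0P.
  (* Each of the two endpoints, at distance [n + 1] from [m], contributes at most
     [2 A K / (n + 1)]. *)
  apply: (@squeeze_cvgr _ _ _ _ (cst 0) (fun n => (4 * A * K) * harmonic n)).
  - apply: nearW => n /=; rewrite normr_ge0/=.
    apply: le_trans (ler_normB _ _) _.
    rewrite -[leLHS](mulfK (x := n.+1%:R))// ler_wpM2r//.
    have := Gle (m + n.+1%:R); have := Gle (m - n.+1%:R).
    rewrite !(addrC m) !addrK normrN normr_nat; nra.
  - exact: cvg_cst.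
  - rewrite -[0](mulr0 (4 * A * K)); apply: cvgM; first exact: cvg_cst.
    exact: cvg_harmonic.
by rewrite /Rintegral (cvg_unique _ lim1 lim2).
Qed.

End normal_stein.

Lemma integrable_sqr_Lfun2 d (T : measurableType d) (R : realType)
    (mu : {measure set T -> \bar R}) (f : T -> R) :
  measurable_fun setT f -> mu.-integrable setT (fun x => (f x ^+ 2)%:E) ->
  f \in Lfun mu 2%:E.
Proof.
move=> mf /integrableP[_ fi]; rewrite inE/=; apply/andP; split; rewrite inE//=.
rewrite /finite_norm unlock /Lnorm poweR_lty//.
apply: le_lt_trans fi; rewrite le_eqVlt; apply/orP; left; apply/eqP.
apply: eq_integral => x _ /=.
by rewrite powR_mulrn// normrX.
Qed.

(** * Moments and cosine transform of a nondegenerate Gaussian variable *)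

Section gaussian_moments.
Context d (T : measurableType d) (R : realType) (P : probability T R).
Variables (X : T -> R) (m s : R).
Hypothesis mX : measurable_fun setT X.
Hypothesis s0 : s != 0.
Hypothesis lawX : forall A : set R, measurable A -> P (X @^-1` A) = normal_prob m s A.

Lemma gaussian_stein (f f' : R -> R) (A : R) :
  (forall x : R, is_derive x 1 f (f' x)) -> continuous f' ->
  (forall x, `|f x| <= A * (1 + `|x - m|)) -> (forall x, `|f' x| <= A) ->
  [/\ P.-integrable setT (fun x => ((X x - m) * f (X x))%:E),
      P.-integrable setT (fun x => (f' (X x))%:E) &
      \int[P]_x ((X x - m) * f (X x)) = s ^+ 2 * \int[P]_x (f' (X x))].
Proof.
move=> df cf' fA f'A.
have A0 : 0 <= A by exact: le_trans (normr_ge0 _) (f'A m).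
have cf : continuous f.
  by move=> x; apply: differentiable_continuous; apply/derivable1_diffP; case: (df x).
have mf : measurable_fun setT f by exact: continuous_measurable_fun.
have mf' : measurable_fun setT f' by exact: continuous_measurable_fun.
have mxm : measurable_fun setT (fun x : R => (x - m) * f x).
  by apply: measurable_funM => //; apply: measurable_funB => //; exact: measurable_id.
have i1 : lebesgue_measure.-integrable setT (fun x => (f' x * normal_pdf m s x)%:E).
  apply: (integrable_normal_quadratic s0 (A := A)) => // x.
  by apply: le_trans (f'A x) _; rewrite ler_peMr// lerDl sqr_ge0.
have i2 : lebesgue_measure.-integrable setT
    (fun x => (((x - m) * f x) * normal_pdf m s x)%:E).
  apply: (integrable_normal_quadratic s0 (A := 2 * A)) => // x.
  rewrite normrM; apply: le_trans (ler_wpM2l (normr_ge0 _) (fA x)) _.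
  rewrite mulrCA -[leRHS]mulrA [leRHS]mulrCA ler_wpM2l//.
  rewrite -[(x - m) ^+ 2]real_normK ?num_real//.
  by have := normr_ge0 (x - m); nra.
split.
- exact: (integrable_gaussian (m := m) (s := s) mX lawX (f := fun x => (x - m) * f x)).
- exact: (integrable_gaussian (m := m) (s := s) mX lawX).
- have := normal_stein s0 df cf' fA f'A; rewrite /Rintegral => H.
  rewrite (integral_gaussian (m := m) (s := s) mX lawX (f := fun x => (x - m) * f x))//.
  by rewrite (integral_gaussian (m := m) (s := s) mX lawX (f := f')).
Qed.

Lemma gaussian_Lfun2 : X \in Lfun P 2%:E.
Proof.
apply: integrable_sqr_Lfun2 => //.
apply: (integrable_gaussian (m := m) (s := s) mX lawX (f := fun x => x ^+ 2)).
  exact: (measurable_funX _ (@measurable_id _ _ setT)).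
apply: (integrable_normal_quadratic s0 (A := 2 + 2 * m ^+ 2)).
  exact: (measurable_funX _ (@measurable_id _ _ setT)).
move=> x; rewrite ger0_norm ?sqr_ge0//.
have := sqr_ge0 (x - m); have := sqr_ge0 m; have := sqr_ge0 (x - m - m).
have := mulr_ge0 (sqr_ge0 m) (sqr_ge0 (x - m)).
nra.
Qed.

(** Stein's identity for the constant function 1. *)
Lemma gaussian_mean : expectation P X = m%:E.
Proof.
have X1 : X \in Lfun P 1.
  exact: (Lfun_subset12 (fin_num_measure P _ measurableT) gaussian_Lfun2).
have iX : P.-integrable setT (EFin \o X) by apply/Lfun1_integrable.
have [|||i1 _] := @gaussian_stein (fun=> 1) (fun=> 0) 1.
- by move=> x; exact: cvg_cst.
- by move=> x; rewrite normr1 mul1r lerDl.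
- by move=> x; rewrite normr0.
have -> : \int[P]_x (0 : R) = 0 by rewrite Rintegral_cst// mul0r.
rewrite mulr0 => H.
have E0 : \int[P]_x (X x - m) = 0.
  by rewrite -[RHS]H; apply: eq_Rintegral => x _; rewrite mulr1.
move: E0; rewrite RintegralB//; last exact: finite_measure_integrable_cst.
rewrite Rintegral_cst// [X in fine X](probability_setT P) mulr1 => /eqP.
rewrite subr_eq0 => /eqP <-.
by rewrite unlock /Rintegral fineK//; exact: integrable_fin_num.
Qed.

(** Stein's identity for [f x = x - m]. *)
Lemma gaussian_variance : variance P X = (s ^+ 2)%:E.
Proof.
have [||||i1 _] := @gaussian_stein (fun x => x - m) (fun=> 1) 1.
- by move=> x; apply: is_derive_eq; rewrite subr0.
- by move=> x; exact: cvg_cst.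
- by move=> x; rewrite mul1r lerDr.
- by move=> x; rewrite normr1.
rewrite Rintegral_cst// [X in fine X](probability_setT P) mul1r mulr1 => H.
rewrite -H /variance unlock gaussian_mean/= unlock /Rintegral fineK//.
by apply: integrable_fin_num => //; case: (gaussian_stein).
Qed.

(** Differentiation under the integral produces [- E[(X - m) sin (t (X - m) + th)]], and Stein's
    identity for this sine turns it back into a multiple of the original integral. *)
Lemma gaussian_cos_ode (th t : R) :
  is_derive t 1 (fun t : R => \int[P]_x cos (t * (X x - m) + th) : R)
    (- (s ^+ 2 * t) * \int[P]_x cos (t * (X x - m) + th)).
Proof.
pose F (t : R) (x : T) : R := cos (t * (X x - m) + th).
have dF (u : R) (x : T) : is_derive u 1 (F ^~ x : R -> R)
    (- ((X x - m) * sin (u * (X x - m) + th))).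
  apply: is_derive_eq; rewrite /GRing.scale/=; ring.
have mcomp (u : R) (h : R -> R) : continuous h ->
    measurable_fun setT (fun x => h (u * (X x - m) + th)).
  move=> /continuous_measurable_fun mh; apply: measurableT_comp => //.
  by apply: measurable_funD => //; apply: measurable_funM => //; apply: measurable_funB.
have iX : P.-integrable setT (fun x => (`|X x - m|)%:E).
  have X1 : X \in Lfun P 1.
    exact: (Lfun_subset12 (fin_num_measure P _ measurableT) gaussian_Lfun2).
  have iX : P.-integrable setT (EFin \o X) by apply/Lfun1_integrable.
  apply: (@integrable_abse _ _ _ _ _ (fun x => (X x - m)%:E)).
  under eq_fun do rewrite EFinB.
  by apply: integrableB => //; exact: finite_measure_integrable_cst.
have iF u : P.-integrable setT (EFin \o F u).
  apply: (@le_integrable _ _ _ P _ measurableT _ (cst 1%:E)).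
  - by apply/measurable_EFinP; apply: (mcomp u); exact: continuous_cos.
  - by move=> x _; rewrite /= lee_fin normr1 cos_max.
  - exact: finite_measure_integrable_cst.
(* The radius 1 is arbitrary: [|X - m|] dominates the derivative for every value of the
   parameter. *)
have t_in : `]t - 1, t + 1[%classic t by rewrite /= in_itv/= ltrBlDr ltrDl ltr01.
have dF' (u : R) x : partial1of2 F u x = - ((X x - m) * sin (u * (X x - m) + th)).
  by rewrite /partial1of2 derive1E; apply: derive_val.
have Fb (u : R) x : `|partial1of2 F u x| <= `|X x - m|.
  by rewrite dF' normrN normrM ler_piMr// sin_max.
have dFx (u : R) x : derivable (F ^~ x : R -> R) u 1 by case: (dF u x).
have der : derivable (fun u : R => \int[P]_(y in setT) F u y : R) t 1.
  exact: (derivable_under_integral measurableT t_in (fun u _ => iF u)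
    (fun u x _ _ => dFx u x) (fun=> normr_ge0 _) iX (fun u x _ _ => Fb u x)).
have := differentiation_under_integral measurableT t_in (fun u _ => iF u)
    (fun u x _ _ => dFx u x) (fun=> normr_ge0 _) iX (fun u x _ _ => Fb u x).
rewrite derive1E => dv.
apply: DeriveDef => //; rewrite dv.
have [||||i1 _ st] := @gaussian_stein (fun y => sin (t * (y - m) + th))
  (fun y => t * cos (t * (y - m) + th)) (1 + `|t|).
- by move=> y; apply: is_derive_eq; rewrite /GRing.scale/=; ring.
- move=> y; apply: cvgM; first exact: cvg_cst.
  apply: continuous_cvg; first exact: continuous_cos.
  apply: cvgD; last exact: cvg_cst.
  apply: cvgM; first exact: cvg_cst.
  by apply: cvgB; [exact: cvg_id|exact: cvg_cst].
- move=> y; apply: le_trans (sin_max _) _.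
  by rewrite mulrDl mul1r -addrA lerDl addr_ge0// mulr_ge0.
- move=> y; rewrite normrM; apply: le_trans (ler_wpM2l (normr_ge0 _) (cos_max _)) _.
  by rewrite mulr1 lerDr.
under eq_Rintegral do rewrite dF' -mulN1r.
rewrite RintegralZl// mulN1r st RintegralZl//; last exact: (iF t).
by rewrite mulNr mulrA.
Qed.

(** By the differential equation, [G] has zero derivative; the formula is [G 1 = G 0]. *)
Lemma gaussian_cos_law (th : R) :
  \int[P]_x cos (X x + th) = cos (m + th) * expR (- s ^+ 2 / 2).
Proof.
pose G (t : R) : R :=
  expR (s ^+ 2 * t ^+ 2 / 2) * \int[P]_x cos (t * (X x - m) + (m + th)).
have dG (t : R) : is_derive t 1 (G : R -> R) 0.
  have := gaussian_cos_ode (m + th) t => dF.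
  by apply: is_derive_eq; rewrite /GRing.scale/=; field.
have := is_derive_0_is_cst 1 0 dG; rewrite /G.
under eq_Rintegral do rewrite mul1r addrA subrK.
under [X in _ = _ * X]eq_Rintegral do rewrite mul0r add0r.
rewrite Rintegral_cst// [X in fine X](probability_setT P) mulr1.
rewrite expr1n mulr1 expr0n/= mulr0 mul0r expR0 mul1r => <-.
by rewrite mulrAC mulNr -expRD subrr expR0 mul1r.
Qed.

End gaussian_moments.

(** In the degenerate case [X] is almost surely equal to [m], and the formula persists with variance
    0. *)
Lemma is_gaussian_cos d (T : measurableType d) (R : realType)
    (P : probability T R) (X : T -> R) (th : R) :
  measurable_fun setT X -> is_gaussian P X ->
  X \in Lfun P 2%:E /\
  \int[P]_x cos (X x + th) =
    cos (fine (expectation P X) + th) * expR (- fine (variance P X) / 2).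
Proof.
move=> mX [m [s [_]]]; rewrite /gaussian_law; case: eqVneq => [_|s0]; last first.
  move=> law; split; first exact: (gaussian_Lfun2 mX s0 law).
  rewrite (gaussian_mean mX s0 law) (gaussian_variance mX s0 law)/=.
  exact: gaussian_cos_law.
move=> law.
have XE : ae_eq P setT X (cst m).
  exists (X @^-1` (~` [set m])); split.
  - rewrite -[X in measurable X]setTI; apply: mX => //.
    exact: measurableC.
  - rewrite [LHS]law; last exact: measurableC.
    by rewrite diracE memNset//= => /(_ erefl).
  - by move=> x /= /not_implyP[_].
have int_f (f : R -> R) : measurable_fun setT f -> (\int[P]_x (f (X x))%:E = (f m)%:E)%E.
  move=> mf; transitivity (\int[P]_x (cst (f m)%:E x))%E.
    apply: ae_eq_integral => //.
      by apply/measurable_EFinP; exact: measurableT_comp.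
    by apply: filterS XE => x /[apply] /= ->.
  by rewrite integral_cst// [X in (_ * X)%E](probability_setT P) mule1.
have m2 : measurable_fun setT (fun x : R => (x - m) ^+ 2).
  by apply: (measurable_funX 2); apply: measurable_funB => //; exact: measurable_id.
have X2 : X \in Lfun P 2%:E.
  have mX2 : measurable_fun setT (fun x : R => x ^+ 2).
    exact: (measurable_funX _ (@measurable_id _ _ setT)).
  apply: integrable_sqr_Lfun2 => //; apply/integrableP; split.
    by apply/measurable_EFinP; exact: (measurable_funX 2).
  under eq_integral => x _ do rewrite /= ger0_norm ?sqr_ge0//.
  by rewrite (int_f (fun x => x ^+ 2))// ltry.
split=> //.
have mcos : measurable_fun setT (fun x : R => cos (x + th)).
  apply: (measurableT_comp (continuous_measurable_fun (@continuous_cos R))).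
  by apply: measurable_funD => //; exact: measurable_id.
rewrite /Rintegral (int_f (fun x => cos (x + th)))//.
have Em : expectation P X = m%:E by rewrite unlock (int_f id).
rewrite Em /variance covariance.unlock Em/= expectation.unlock.
under eq_integral do rewrite /= -expr2.
by rewrite (int_f (fun x => (x - m) ^+ 2))// subrr expr0n/= oppr0 mul0r expR0 mulr1.
Qed.

(** * Closure of an algebra of bounded functions in L2 *)

Lemma quadratic_ge0_discr (R : realFieldType) (a b c : R) :
  0 <= a -> (forall t, 0 <= a * t ^+ 2 - 2 * b * t + c) -> b ^+ 2 <= a * c.
Proof.
rewrite le_eqVlt => /orP[/eqP a0|a0] H; last first.
  (* The minimiser of the quadratic. *)
  have := H (b / a).
  have -> : a * (b / a) ^+ 2 - 2 * b * (b / a) + c = c - b ^+ 2 / a.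
    by field; rewrite gt_eqF.
  by rewrite subr_ge0 ler_pdivrMr// mulrC.
rewrite -a0 mul0r real_exprn_even_le0 ?num_real//=.
  apply/eqP; apply: contrapT => /eqP b0.
  (* If [a = 0] and [b] is nonzero, the affine function takes the value -1 at this point. *)
  have := H ((c + 1) / (2 * b)); rewrite -a0 mul0r add0r mulrC divfK ?mulf_neq0//.
  lra.
Qed.

Section bounded_measurable.
Context d (T : measurableType d) (R : realType) (P : probability T R).

(** An algebra of functions integrable for any probability, so that integrability of products needs
    no moment condition. *)
Definition bounded_measurable (f : T -> R) :=
  measurable_fun setT f /\ exists M, forall x, `|f x| <= M.

Local Notation bm := bounded_measurable.

Lemma bm_integrable f : bm f -> P.-integrable setT (fun x => (f x)%:E).
Proof.
move=> [mf [M fM]].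
apply: (@le_integrable _ _ _ P _ measurableT _ (cst M%:E)).
- exact/measurable_EFinP.
- by move=> x _; rewrite /= lee_fin; apply: le_trans (fM x) (ler_norm _).
- exact: finite_measure_integrable_cst.
Qed.

Lemma bm_cst c : bm (fun=> c).
Proof. by split; [exact: measurable_cst|exists `|c|]. Qed.

Lemma bmD f g : bm f -> bm g -> bm (fun x => f x + g x).
Proof.
move=> [mf [M fM]] [mg [N gN]]; split; first exact: measurable_funD.
by exists (M + N) => x; apply: le_trans (ler_normD _ _) _; exact: lerD.
Qed.

Lemma bmM f g : bm f -> bm g -> bm (fun x => f x * g x).
Proof.
move=> [mf [M fM]] [mg [N gN]]; split; first exact: measurable_funM.
by exists (M * N) => x; rewrite normrM; apply: ler_pM.
Qed.

Lemma bmB f g : bm f -> bm g -> bm (fun x => f x - g x).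
Proof.
move=> bf bg; have := bmD bf (bmM (bm_cst (-1)) bg).
by under eq_fun do rewrite mulN1r.
Qed.

Lemma bmX f n : bm f -> bm (fun x => f x ^+ n).
Proof.
move=> bf; elim: n => [|n IH]; first exact: bm_cst.
by under eq_fun do rewrite exprS; exact: bmM.
Qed.

Lemma bm_indic A : measurable A -> bm (\1_A : T -> R).
Proof.
move=> mA; split; first exact: measurable_indic.
by exists 1 => x; rewrite indicE; case: (x \in A); rewrite ?normr1 ?normr0.
Qed.

(** Discriminant of the nonnegative quadratic [E[(t f - g)^2]] in [t]. *)
Lemma Rintegral_cauchy_schwarz f g : bm f -> bm g ->
  (\int[P]_x (f x * g x)) ^+ 2 <=
  \int[P]_x (f x ^+ 2) * \int[P]_x (g x ^+ 2).
Proof.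
move=> bf bg.
set a := \int[P]_x (f x ^+ 2); set b := \int[P]_x (f x * g x).
set c := \int[P]_x (g x ^+ 2).
have H (t : R) : 0 <= a * t ^+ 2 - 2 * b * t + c.
  have : 0 <= \int[P]_x ((t * f x - g x) ^+ 2).
    by apply: Rintegral_ge0 => x _; exact: sqr_ge0.
  have -> : (fun x => (t * f x - g x) ^+ 2) =
     (fun x => t ^+ 2 * f x ^+ 2 + (- (2 * t) * (f x * g x) + g x ^+ 2)).
    by apply/funext => x; ring.
  have i1 := bm_integrable (bmX 2 bf).
  have i2 := bm_integrable (bmM bf bg).
  have i3 := bm_integrable (bmX 2 bg).
  have i4 := bm_integrable (bmM (bm_cst (t ^+ 2)) (bmX 2 bf)).
  have i5 := bm_integrable (bmM (bm_cst (- (2 * t))) (bmM bf bg)).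
  have i6 := bm_integrable (bmD (bmM (bm_cst (- (2 * t))) (bmM bf bg)) (bmX 2 bg)).
  rewrite RintegralD// RintegralD// !RintegralZl// -/a -/b -/c.
  by congr (0 <= _); ring.
by apply: quadratic_ge0_discr => //; apply: Rintegral_ge0 => x _; exact: sqr_ge0.
Qed.

End bounded_measurable.

Section L2_closure.
Context d (T : measurableType d) (R : realType) (P : probability T R).
Local Notation bm := (@bounded_measurable d T R).
Variable Q : set (T -> R).
Hypothesis Qbm : forall q, Q q -> bm q.
Hypothesis Qcst : forall c, Q (fun=> c).
Hypothesis QD : forall p q, Q p -> Q q -> Q (fun x => p x + q x).
Hypothesis QM : forall p q, Q p -> Q q -> Q (fun x => p x * q x).

(** The bounded part of the [L^2] closure of [Q]: boundedness keeps it stable under products. The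
    error [e] bounds the squared norm. *)
Definition L2_approx (f : T -> R) := bm f /\
  forall e, 0 < e -> exists2 q, Q q & \int[P]_x ((f x - q x) ^+ 2) <= e.

Lemma L2_approx_id q : Q q -> L2_approx q.
Proof.
move=> Qq; split=> [|e e0]; first exact: Qbm.
exists q => //; under eq_Rintegral do rewrite subrr expr0n/=.
by rewrite Rintegral_cst// mul0r ltW.
Qed.

Lemma Rintegral_sqrD_le (a b : T -> R) : bm a -> bm b ->
  \int[P]_x ((a x + b x) ^+ 2) <=
  2 * \int[P]_x (a x ^+ 2) + 2 * \int[P]_x (b x ^+ 2).
Proof.
move=> ba bb.
have i1 := bm_integrable P (bmX 2 ba); have i2 := bm_integrable P (bmX 2 bb).
have c1 := bmM (bm_cst _ 2) (bmX 2 ba).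
have c2 := bmM (bm_cst _ 2) (bmX 2 bb).
have j1 := bm_integrable P c1; have j2 := bm_integrable P c2.
rewrite -!RintegralZl// -RintegralD//; apply: le_Rintegral => //.
- exact: (bm_integrable P (bmX 2 (bmD ba bb))).
- exact: (bm_integrable P (bmD c1 c2)).
- by move=> x _; have := sqr_ge0 (a x - b x); nra.
Qed.

Lemma L2_approxD f g : L2_approx f -> L2_approx g ->
  L2_approx (fun x => f x + g x).
Proof.
move=> [bf af] [bg ag]; split; first exact: bmD.
move=> e e0; have e4 : 0 < e / 4 by rewrite divr_gt0.
have [p Qp pe] := af _ e4; have [q Qq qe] := ag _ e4.
exists (fun x => p x + q x); first exact: QD.
have -> : (fun x => (f x + g x - (p x + q x)) ^+ 2) =
          (fun x => ((f x - p x) + (g x - q x)) ^+ 2).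
  by apply/funext => x; ring.
apply: le_trans (Rintegral_sqrD_le (bmB bf (Qbm Qp)) (bmB bg (Qbm Qq))) _.
lra.
Qed.

(** From [f g - p q = f (g - q) + (f - p) q]. The approximant [q] is chosen first, against a bound
    of [f]; then [p], against a bound of [q], which no bound of [g] controls. *)
Lemma L2_approxM f g : L2_approx f -> L2_approx g ->
  L2_approx (fun x => f x * g x).
Proof.
move=> [bf af] [bg ag]; split; first exact: bmM.
move=> e e0.
have [_ [M fM]] := bf.
have M0 : 0 < 1 + M ^+ 2 by rewrite ltr_pwDl ?sqr_ge0.
have [q Qq qe] := ag (e / (4 * (1 + M ^+ 2))) (divr_gt0 e0 (mulr_gt0 (ltr0n _ 4) M0)).
have [_ [N qN]] := Qbm Qq.
have N0 : 0 < 1 + N ^+ 2 by rewrite ltr_pwDl ?sqr_ge0.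
have [p Qp pe] := af (e / (4 * (1 + N ^+ 2))) (divr_gt0 e0 (mulr_gt0 (ltr0n _ 4) N0)).
exists (fun x => p x * q x); first exact: QM.
have bd1 := bmM bf (bmB bg (Qbm Qq)).
have bd2 := bmM (bmB bf (Qbm Qp)) (Qbm Qq).
have -> : (fun x => (f x * g x - p x * q x) ^+ 2) =
          (fun x => (f x * (g x - q x) + (f x - p x) * q x) ^+ 2).
  by apply/funext => x; ring.
apply: le_trans (Rintegral_sqrD_le bd1 bd2) _.
have bound (a b : T -> R) (C D : R) :
    bm a -> bm b -> 0 < 1 + C ^+ 2 -> (forall x, `|a x| <= C) ->
    \int[P]_x (b x ^+ 2) <= D / (4 * (1 + C ^+ 2)) ->
    \int[P]_x ((a x * b x) ^+ 2) <= D / 4.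
  move=> ba bb C0 aC bD.
  apply: (@le_trans _ _ (\int[P]_x ((1 + C ^+ 2) * b x ^+ 2))).
    apply: le_Rintegral => //.
    - exact: (bm_integrable P (bmX 2 (bmM ba bb))).
    - exact: (bm_integrable P (bmM (bm_cst _ _) (bmX 2 bb))).
    - move=> x _; rewrite exprMn ler_wpM2r ?sqr_ge0// -[a x ^+ 2]real_normK ?num_real//.
      by have := normr_ge0 (a x); have := aC x; nra.
  rewrite RintegralZl//; last exact: (bm_integrable P (bmX 2 bb)).
  rewrite mulrC -ler_pdivlMr//; apply: le_trans bD _.
  by rewrite invfM mulrA.
have b1 := bound _ _ _ e bf (bmB bg (Qbm Qq)) M0 fM qe.
have b2 := bound _ _ _ e (Qbm Qq) (bmB bf (Qbm Qp)) N0 qN pe.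
under [X in _ + 2 * X]eq_Rintegral do rewrite mulrC.
lra.
Qed.

Lemma L2_approxX f n : L2_approx f -> L2_approx (fun x => f x ^+ n).
Proof.
move=> af; elim: n => [|n IH]; first exact/L2_approx_id/Qcst.
by under eq_fun do rewrite exprS; exact: L2_approxM.
Qed.

Lemma L2_approxZ c f : L2_approx f -> L2_approx (fun x => c * f x).
Proof. by move=> af; apply: L2_approxM => //; exact/L2_approx_id/Qcst. Qed.

Lemma L2_approxB f g : L2_approx f -> L2_approx g ->
  L2_approx (fun x => f x - g x).
Proof.
move=> af ag; have := L2_approxD af (L2_approxZ (-1) ag).
by under eq_fun do rewrite mulN1r.
Qed.

(** Bounded convergence: the squared differences are at most [(2 M)^2]. *)
Lemma L2_approx_lim (f_ : nat -> T -> R) f (M : R) :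
  (forall n, L2_approx (f_ n)) -> (forall n x, `|f_ n x| <= M) ->
  (forall x, f_ n x @[n --> \oo] --> f x) -> L2_approx f.
Proof.
move=> af fM cf.
have mf : measurable_fun setT f.
  by apply: (@measurable_fun_cvg _ _ _ _ f_) => // n; case: (af n) => -[].
have fb x : `|f x| <= M.
  have c : `|f_ n x| @[n --> \oo] --> `|f x| by exact: cvg_norm.
  by rewrite -(cvg_lim _ c)//; apply: limr_le; [exact: cvgP c|exact: nearW].
have bf : bm f by split=> //; exists M.
split=> // e e0.
have lim0 : (\int[P]_x ((f x - f_ n x) ^+ 2)%:E)%E @[n --> \oo] -->
    (\int[P]_x (cst 0%:E x))%E.
  apply: (@dominated_cvg _ _ _ P _ measurableT _ _ (cst ((2 * M) ^+ 2)%:E)) => //.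
  - move=> n; apply/measurable_EFinP; apply: (measurable_funX 2).
    by apply: measurable_funB => //; case: (af n) => -[].
  - move=> x _; apply: cvg_EFin; first exact: nearW.
    rewrite (_ : 0 = (f x - f x) * (f x - f x)); last by rewrite subrr mulr0.
    rewrite /comp /=; under eq_cvg do rewrite expr2.
    have c : f x - f_ n x @[n --> \oo] --> f x - f x by apply: cvgB => //; exact: cvg_cst.
    exact: cvgM.
  - exact: finite_measure_integrable_cst.
  - move=> n x _; rewrite /= lee_fin normrX lerXn2r ?nnegrE//.
      by rewrite mulr_ge0// (le_trans _ (fb x)).
    by apply: le_trans (ler_normB _ _) _; have := fb x; have := fM n x; lra.
rewrite integral0 in lim0.
have e4 : 0 < e / 4 by rewrite divr_gt0.
have /fine_cvgP[_ /cvgrPdist_le/(_ _ e4) [N _ /(_ N (leqnn N))]] := lim0.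
rewrite /= sub0r normrN => fN.
have [q Qq qe] := (af N).2 _ e4.
exists q => //.
have -> : (fun x => (f x - q x) ^+ 2) =
          (fun x => ((f x - f_ N x) + (f_ N x - q x)) ^+ 2).
  by apply/funext => x; ring.
apply: le_trans (Rintegral_sqrD_le (bmB bf (af N).1) (bmB (af N).1 (Qbm Qq))) _.
have := le_trans (ler_norm _) fN; rewrite -/(Rintegral _ _ _); lra.
Qed.

End L2_closure.

(** * Polynomials approximating a jump at 1/2 *)

Lemma bernoulli_le (R : realFieldType) (x : R) (n : nat) :
  0 <= x <= 1 -> 1 - n%:R * x <= (1 - x) ^+ n.
Proof.
move=> /andP[x0 x1]; elim: n => [|n IH]; first by rewrite mul0r subr0 expr0.
rewrite exprS; apply: (@le_trans _ _ ((1 - x) * (1 - n%:R * x))); last first.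
  by rewrite ler_wpM2l// subr_ge0.
rewrite -natr1; have := mulr_ge0 (ler0n R n) (sqr_ge0 x); nra.
Qed.

(** Since [n x <= (1 + x)^n], the product is at most [(1 - x^2)^n]. *)
Lemma expr_onem_mul_le (R : realFieldType) (x : R) (n : nat) :
  0 <= x <= 1 -> (1 - x) ^+ n * (n%:R * x) <= 1.
Proof.
move=> /andP[x0 x1].
have p0 : 0 <= (1 - x) ^+ n by rewrite exprn_ge0// subr_ge0.
have : n%:R * x <= (1 + x) ^+ n.
  elim: n {p0} => [|n IH]; first by rewrite mul0r expr0.
  have h : 1 <= (1 + x) ^+ n by rewrite exprn_ege1// lerDl.
  by rewrite exprS -natr1; nra.
move=> /(ler_wpM2l p0) /le_trans; apply.
by rewrite -exprMn exprn_ile1//; nra.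
Qed.

(** Bernoulli's inequality bounds the sequence below by [1 - (2 g)^n]. These polynomials are the
    ones of an elementary proof of the Stone-Weierstrass theorem. *)
Lemma cvg_onem_expr_lt (R : realType) (g : R) : 0 <= g < 1 / 2 ->
  (1 - g ^+ n) ^+ (2 ^ n) @[n --> \oo] --> (1 : R).
Proof.
move=> /andP[g0 g2].
have g1 n : 0 <= g ^+ n <= 1 by rewrite exprn_ge0// exprn_ile1//; lra.
apply: (@squeeze_cvgr _ _ _ _ (fun n => 1 - (2 * g) ^+ n) (cst 1)).
- apply: nearW => n; apply/andP; split; last first.
    by have /andP[a b] := g1 n; rewrite exprn_ile1//; lra.
  by apply: le_trans (bernoulli_le _ (g1 n)); rewrite exprMn natrX.
- rewrite -[X in _ --> X]subr0; apply: cvgB; first exact: cvg_cst.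
  by apply: cvg_expr; rewrite ger0_norm; lra.
- exact: cvg_cst.
Qed.

(** Here the sequence is at most [(2 g)^-n], with [2 g > 1]. *)
Lemma cvg_onem_expr_gt (R : realType) (g : R) : 1 / 2 < g <= 1 ->
  (1 - g ^+ n) ^+ (2 ^ n) @[n --> \oo] --> (0 : R).
Proof.
move=> /andP[g2 gle1].
have g1 n : 0 <= g ^+ n <= 1 by rewrite exprn_ge0 ?exprn_ile1//; lra.
apply: (@squeeze_cvgr _ _ _ _ (cst 0) (fun n => (2 * g)^-1 ^+ n)).
- apply: nearW => n; rewrite exprn_ge0/=; last first.
    by have /andP[a b] := g1 n; rewrite subr_ge0.
  rewrite exprVn -[leRHS]mul1r ler_pdivlMr ?exprn_gt0//; last lra.
  by rewrite exprMn -natrX expr_onem_mul_le.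
- exact: cvg_cst.
- by apply: cvg_expr; rewrite ger0_norm ?invr_ge0 ?invf_lt1; lra.
Qed.

(** * The sigma-algebra of events with approximable indicator *)

Section approx_events.
Context d (T : measurableType d) (R : realType) (P : probability T R).
Local Notation bm := (@bounded_measurable d T R).
Variable Q : set (T -> R).
Hypothesis Qbm : forall q, Q q -> bm q.
Hypothesis Qcst : forall c, Q (fun=> c).
Hypothesis QD : forall p q, Q p -> Q q -> Q (fun x => p x + q x).
Hypothesis QM : forall p q, Q p -> Q q -> Q (fun x => p x * q x).
Local Notation ap := (L2_approx P Q).

Definition approx_event (A : set T) := measurable A /\ ap (\1_A : T -> R).

Lemma L2_approx_indic (A : set T) : ap (\1_A : T -> R) -> approx_event A.
Proof.
move=> a; split=> //; have [[m1 _] _] := a.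
have -> : A = (\1_A : T -> R) @^-1` [set 1].
  apply/seteqP; split => x /=; rewrite indicE; first by move/mem_set ->.
  by case: (boolP (x \in A)) => [/set_mem//|_ /eqP]; rewrite eq_sym oner_eq0.
by rewrite -[X in measurable X]setTI; exact: m1.
Qed.

Let ap_cst c : ap (fun=> c).
Proof. exact/L2_approx_id/Qcst. Qed.

Lemma approx_eventC A : approx_event A -> approx_event (~` A).
Proof.
move=> [mA aA]; split; first exact: measurableC.
have -> : (\1_(~` A) : T -> R) = (fun x => 1 - \1_A x).
  by apply/funext => x; rewrite !indicE in_setC; case: (x \in A); rewrite ?subrr ?subr0.
exact: L2_approxB.
Qed.

Lemma approx_eventU A B : approx_event A -> approx_event B -> approx_event (A `|` B).
Proof.
move=> [mA aA] [mB aB]; split; first exact: measurableU.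
have -> : (\1_(A `|` B) : T -> R) = (fun x => (\1_A x + \1_B x) - \1_A x * \1_B x).
  apply/funext => x; rewrite !indicE in_setU.
  by case: (x \in A); case: (x \in B); rewrite /=; ring.
by apply: L2_approxB => //; [exact: L2_approxD|exact: L2_approxM].
Qed.

Lemma approx_event0 : approx_event set0.
Proof. by split => //; rewrite indic0; exact: ap_cst. Qed.

Lemma approx_event_lim (A_ : nat -> set T) (A : set T) :
  (forall n, approx_event (A_ n)) -> (forall x, \forall n \near \oo, A_ n x <-> A x) ->
  approx_event A.
Proof.
move=> aA cA.
have c x : (\1_(A_ n) x : R) @[n --> \oo] --> (\1_A x : R).
  apply: cvg_near_cst; apply: filterS (cA x) => n AE.
  rewrite !indicE; congr (_ %:R); congr nat_of_bool.
  by apply/idP/idP; rewrite !inE => /AE.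
have a : ap (\1_A : T -> R).
  apply: (L2_approx_lim (M := 1) Qbm _ _ c).
  - by move=> n; case: (aA n).
  - by move=> n x; rewrite indicE; case: (_ \in _); rewrite ?normr1 ?normr0.
exact: L2_approx_indic.
Qed.

Lemma approx_event_bigcup (A_ : nat -> set T) :
  (forall n, approx_event (A_ n)) -> approx_event (\bigcup_n A_ n).
Proof.
move=> aA; apply: (@approx_event_lim (fun n => \big[setU/set0]_(i < n) A_ i)).
  move=> n; elim: n => [|n IH]; first by rewrite big_ord0; exact: approx_event0.
  by rewrite big_ord_recr/=; exact: approx_eventU.
move=> x; have [[k _ Akx]|nA] := pselect ((\bigcup_n A_ n) x).
  exists k.+1 => // n /= kn; split=> _; first by exists k.
  by rewrite -bigcup_mkord; exists k.
apply: nearW => n; split=> // H; exfalso; apply: nA.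
by move: H; rewrite -bigcup_mkord => -[k _ ?]; exists k.
Qed.

Lemma approx_event_sigma_algebra : sigma_algebra setT approx_event.
Proof.
split.
- exact: approx_event0.
- by move=> A aA; rewrite setTD; exact: approx_eventC.
- exact: approx_event_bigcup.
Qed.

Lemma approx_fun_event (f_ : nat -> T -> R) (A : set T) (M : R) :
  (forall n, ap (f_ n)) -> (forall n x, `|f_ n x| <= M) ->
  (forall x, f_ n x @[n --> \oo] --> (\1_A x : R)) -> approx_event A.
Proof.
move=> af fM cf.
exact: L2_approx_indic (L2_approx_lim Qbm af fM cf).
Qed.

(** The indicator is the limit of [1 - (1 - f)^n]. *)
Lemma approx_event_neq0 f : ap f -> (forall x, 0 <= f x <= 1) ->
  approx_event [set x | f x != 0].
Proof.
move=> af f01.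
have h n x : 0 <= (1 - f x) ^+ n <= 1.
  have /andP[a b] := f01 x.
  by rewrite exprn_ge0 ?exprn_ile1//; lra.
apply: (@approx_fun_event (fun n x => 1 - (1 - f x) ^+ n) _ 1).
- by move=> n; apply: L2_approxB => //; apply: L2_approxX => //; exact: L2_approxB.
- by move=> n x; have /andP[a b] := h n x; rewrite ger0_norm; lra.
- move=> x; rewrite indicE; case: (boolP (x \in _)) => [/set_mem /= fx0|].
    rewrite -[X in _ --> X]subr0; apply: cvgB; first exact: cvg_cst.
    apply: cvg_expr; have /andP[a b] := f01 x.
    by rewrite ger0_norm ?ltrBlDr ?ltrDl ?lt_neqAle 1?eq_sym ?fx0 ?subr_ge0.
  rewrite notin_setE/= => /negP; rewrite negbK => /eqP ->.
  by under eq_cvg do rewrite subr0 expr1n subrr; exact: cvg_cst.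
Qed.

(* With [g = (1 + f) / 2], [(1 - g^n)^(2^n)] tends to 1 where [f < 0] and to 0
   where [0 < f]; the factor [\1_[f != 0]] takes care of the remaining points. *)
Lemma approx_event_lt0 f : ap f -> (forall x, `|f x| <= 1) ->
  approx_event [set x | f x < 0].
Proof.
move=> af f1.
have f11 x : - 1 <= f x <= 1 by rewrite -ler_norml.
pose g x := (1 / 2) * (1 + f x).
have ag : ap g by apply: L2_approxZ => //; exact: L2_approxD.
have g01 x : 0 <= g x <= 1 by have /andP[a b] := f11 x; rewrite /g; lra.
(* Squaring brings the values into [0, 1] and keeps the zero set. *)
have aN : approx_event [set x | f x ^+ 2 != 0].
  apply: approx_event_neq0; first exact: L2_approxX.
  by move=> x; have /andP[a b] := f11 x; rewrite sqr_ge0; nra.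
have h n x : 0 <= (1 - g x ^+ n) ^+ (2 ^ n) <= 1.
  have /andP[a b] := g01 x.
  have : 0 <= g x ^+ n <= 1 by rewrite exprn_ge0 ?exprn_ile1.
  by move=> /andP[? ?]; rewrite exprn_ge0 ?exprn_ile1//; lra.
apply: (@approx_fun_event (fun n x =>
  (1 - g x ^+ n) ^+ (2 ^ n) * \1_[set x | f x ^+ 2 != 0] x) _ 1).
- move=> n; apply: L2_approxM => //; last by case: aN.
  by apply: L2_approxX => //; apply: L2_approxB => //; exact: L2_approxX.
- move=> n x; have /andP[a b] := h n x.
  rewrite normrM ger0_norm// indicE; case: (_ \in _); rewrite ?normr1 ?normr0; lra.
- move=> x; rewrite !indicE; case: (ltgtP (f x) 0) => fx.
  + rewrite !mem_set//=; last by rewrite expf_neq0// lt_eqF.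
    under eq_cvg do rewrite mulr1; apply: cvg_onem_expr_lt.
    by have /andP[a b] := f11 x; rewrite /g; lra.
  + rewrite mem_set/=; last by rewrite expf_neq0// gt_eqF.
    rewrite memNset/=; last by rewrite ltNge ltW.
    under eq_cvg do rewrite mulr1; apply: cvg_onem_expr_gt.
    by have /andP[a b] := f11 x; rewrite /g; lra.
  + rewrite !memNset/= ?fx ?ltxx ?expr0n ?eqxx//=.
    by under eq_cvg do rewrite mulr0; exact: cvg_cst.
Qed.

(* The ray [X < a] is the limit of the events [sin ((X - a) / (n + 1)) < 0]. *)
Lemma approx_event_preimage (X : T -> R) :
  (forall a b, Q (fun x => sin (a * X x + b))) ->
  forall B : set R, measurable B -> approx_event (X @^-1` B).
Proof.
move=> QX.
have ray a : approx_event [set x | X x < a].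
  apply: (@approx_event_lim (fun n =>
      [set x | sin (n.+1%:R^-1 * X x + - (n.+1%:R^-1 * a)) < 0])).
    move=> n; apply: approx_event_lt0; first exact/L2_approx_id/QX.
    by move=> x; exact: sin_max.
  (* From this index on, the argument of the sine lies strictly between -1 and 1, hence between
     [- pi] and [pi], where the sine has the sign of its argument. *)
  move=> x /=; exists (Num.truncn `|X x - a|) => // n /= xn.
  rewrite -mulrBr; set y := X x - a.
  have yn : `|y| < n.+1%:R.
    by apply: lt_le_trans (truncnS_gt _) _; rewrite ler_nat.
  have n0 : 0 < n.+1%:R^-1 :> R by rewrite invr_gt0 ltr0n.
  have zpi (z : R) : 0 <= z < n.+1%:R -> n.+1%:R^-1 * z < pi.
    move=> /andP[z0 zn]; apply: (@lt_trans _ _ 1); last first.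
      by apply: lt_le_trans (pi_ge2 R); rewrite ltr1n.
    by rewrite mulrC ltr_pdivrMr ?ltr0n// mul1r.
  have -> : (X x < a) = (y < 0) by rewrite /y subr_lt0.
  case: (ltgtP y 0) => y0; split => //.
  - move=> _; rewrite -oppr_gt0 -sinN -mulrN; apply: sin_gt0_pi.
    rewrite mulr_gt0 ?oppr_gt0//= zpi// oppr_ge0 ltW//=.
    by rewrite -ltr0_norm.
  - rewrite ltNge sin_ge0_pi//.
    rewrite mulr_ge0 ?ltW//= zpi// ltW//=.
    by rewrite -(gtr0_norm y0).
  - by rewrite y0 mulr0 sin0 ltxx.
(* The open left rays generate the Borel sets. *)
have sub : @RGenInftyO.G R `<=` [set B : set R | approx_event (X @^-1` B)].
  by move=> _ [a ->]; rewrite /= preimage_itvNyo.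
have salg : sigma_algebra setT [set B : set R | approx_event (X @^-1` B)].
  split => /=.
  - by rewrite preimage_set0; exact: approx_event0.
  - by move=> B aB; rewrite setTD preimage_setC; exact: approx_eventC.
  - by move=> B aB; rewrite preimage_bigcup; exact: approx_event_bigcup.
move=> B mB; have : @measurable _ (measurableTypeR R) B by exact: mB.
rewrite [X in X _]RGenInftyO.measurableE => H; exact: (smallest_sub salg sub H).
Qed.

End approx_events.

(** * Projections and cones *)

Section covariance_form.
Context d (T : measurableType d) (R : realType) (P : probability T R).

Local Notation L2 := (fun X : T -> R => X \in Lfun P 2%:E).

(** [fine] sends infinite values to 0; the algebraic rules below therefore assume square
    integrability where finiteness matters. *)
Definition mean (X : T -> R) : R := fine (expectation P X).
Definition cov (X Y : T -> R) : R := fine (covariance P X Y).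

Let Lfun21 X : L2 X -> X \in Lfun P 1.
Proof. exact: (Lfun_subset12 (fin_num_measure P _ measurableT)). Qed.

Let cov_fin X Y : L2 X -> L2 Y -> covariance P X Y \is a fin_num.
Proof.
move=> X2 Y2; apply: covariance_fin_num; [exact: Lfun21|exact: Lfun21|].
exact: Lfun2_mul_Lfun1.
Qed.

Let mean_fin X : L2 X -> expectation P X \is a fin_num.
Proof. by move=> X2; rewrite expectation_fin_num ?Lfun21. Qed.

Lemma L2_measurable X : L2 X -> measurable_fun setT X.
Proof. by move=> /= /andP[]; rewrite !inE. Qed.

Lemma L2_cst c : L2 (fun=> c).
Proof. exact: Lfun_cst. Qed.

Lemma L2D X Y : L2 X -> L2 Y -> L2 (fun x => X x + Y x).
Proof.
have lee12 : (1 <= 2%:E :> \bar R)%E by rewrite lee_fin ler1n.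
by move=> X2 Y2; apply: (rpredD (S := @Lfun _ _ _ P 2%:E)).
Qed.

Lemma L2Z c X : L2 X -> L2 (fun x => c * X x).
Proof.
move=> X2; rewrite (_ : (fun x => c * X x) = (c \o* X)); last first.
  by apply/funext => x /=; rewrite mulrC.
by apply: Lfun_scale => //; rewrite ler1n.
Qed.

Lemma L2B X Y : L2 X -> L2 Y -> L2 (fun x => X x - Y x).
Proof.
move=> X2 Y2; have := L2D X2 (L2Z (-1) Y2).
by under eq_fun do rewrite mulN1r.
Qed.

Lemma meanD X Y : L2 X -> L2 Y -> mean (fun x => X x + Y x) = mean X + mean Y.
Proof.
move=> X2 Y2; rewrite /mean [expectation _ _](@expectationD _ _ _ P X Y) ?Lfun21//.
by rewrite fineD ?mean_fin.
Qed.

Lemma meanZ c X : L2 X -> mean (fun x => c * X x) = c * mean X.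
Proof.
move=> X2; rewrite /mean (_ : (fun x => c * X x) = (c \o* X)); last first.
  by apply/funext => x /=; rewrite mulrC.
by rewrite expectationZl ?Lfun21// fineM ?mean_fin.
Qed.

Lemma mean_cst c : mean (fun=> c) = c.
Proof. by rewrite /mean [expectation _ _]expectation_cst. Qed.

Lemma meanB X Y : L2 X -> L2 Y -> mean (fun x => X x - Y x) = mean X - mean Y.
Proof.
move=> X2 Y2; rewrite -mulN1r -meanZ// -meanD//; last exact: L2Z.
by congr mean; apply/funext => x; rewrite mulN1r.
Qed.

Lemma covC X Y : cov X Y = cov Y X.
Proof. by rewrite /cov covarianceC. Qed.

Lemma covDl X Y W : L2 X -> L2 Y -> L2 W ->
  cov (fun x => X x + Y x) W = cov X W + cov Y W.
Proof.
move=> X2 Y2 W2; rewrite /cov [covariance _ _ _](@covarianceDl _ _ _ P X Y W)//.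
by rewrite fineD ?cov_fin.
Qed.

Lemma covZl c X W : L2 X -> L2 W -> cov (fun x => c * X x) W = c * cov X W.
Proof.
move=> X2 W2; rewrite /cov (_ : (fun x => c * X x) = (c \o* X)); last first.
  by apply/funext => x /=; rewrite mulrC.
rewrite covarianceZl; [|exact: Lfun21|exact: Lfun21|exact: Lfun2_mul_Lfun1].
by rewrite fineM ?cov_fin.
Qed.

Lemma cov_cstl c W : cov (fun=> c) W = 0.
Proof. by rewrite /cov [covariance _ _ _]covariance_cst_l. Qed.

Lemma covBl X Y W : L2 X -> L2 Y -> L2 W ->
  cov (fun x => X x - Y x) W = cov X W - cov Y W.
Proof.
move=> X2 Y2 W2; rewrite -mulN1r -covZl// -covDl//; last exact: L2Z.
by congr cov; apply/funext => x; rewrite mulN1r.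
Qed.

Lemma covDr X Y W : L2 X -> L2 Y -> L2 W ->
  cov W (fun x => X x + Y x) = cov W X + cov W Y.
Proof. by move=> X2 Y2 W2; rewrite !(covC W) covDl. Qed.

Lemma covBr X Y W : L2 X -> L2 Y -> L2 W ->
  cov W (fun x => X x - Y x) = cov W X - cov W Y.
Proof. by move=> X2 Y2 W2; rewrite !(covC W) covBl. Qed.

Lemma covZr c X W : L2 X -> L2 W -> cov W (fun x => c * X x) = c * cov W X.
Proof. by move=> X2 W2; rewrite !(covC W) covZl. Qed.

Lemma cov_cstr c W : cov W (fun=> c) = 0.
Proof. by rewrite covC cov_cstl. Qed.

Lemma cov_ge0 X : 0 <= cov X X.
Proof. by rewrite fine_ge0//; exact: variance_ge0. Qed.

Lemma cov_cauchy_schwarz X Y : L2 X -> L2 Y ->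
  cov X Y ^+ 2 <= cov X X * cov Y Y.
Proof.
move=> X2 Y2; apply: quadratic_ge0_discr; first exact: cov_ge0.
move=> t; have := cov_ge0 (fun x => t * X x - Y x).
have tX2 := L2Z t X2; have tXY2 := L2B tX2 Y2.
rewrite covBl// covBr// covBr// !covZl// covZr// covZr// (covC Y X).
by congr (0 <= _); ring.
Qed.

(** * Linear and affine combinations of a block of the process, and projections *)

Variable Z : nat -> T -> R.
Hypothesis Z2 : forall i, L2 (Z i).

Definition lin (r : seq nat) (c : nat -> R) : T -> R :=
  fun x => \sum_(i <- r) c i * Z i x.

Lemma lin_nil c : lin [::] c = fun=> 0.
Proof. by apply/funext => x; rewrite /lin big_nil. Qed.

Lemma lin_cons i r c : lin (i :: r) c = fun x => c i * Z i x + lin r c x.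
Proof. by apply/funext => x; rewrite /lin big_cons. Qed.

Lemma L2_lin r c : L2 (lin r c).
Proof.
elim: r => [|i r IH]; first by rewrite lin_nil; exact: L2_cst.
by rewrite lin_cons; apply: L2D => //; exact: L2Z.
Qed.

Lemma cov_linl r c W : L2 W -> cov (lin r c) W = \sum_(i <- r) c i * cov (Z i) W.
Proof.
move=> W2; elim: r => [|i r IH]; first by rewrite lin_nil cov_cstl big_nil.
rewrite lin_cons covDl//; [|exact: L2Z|exact: L2_lin].
by rewrite big_cons IH covZl.
Qed.

Lemma cov_lin r c s e :
  cov (lin r c) (lin s e) =
  \sum_(i <- r) \sum_(j <- s) (c i * e j) * cov (Z i) (Z j).
Proof.
rewrite cov_linl; last exact: L2_lin.
apply: eq_bigr => i _; rewrite covC cov_linl// big_distrr/=.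
by apply: eq_bigr => j _; rewrite covC mulrA.
Qed.

(** The block is half-open, [n <= i < N]. The constant lets a projection have a prescribed mean and
    a cosine have a phase. *)
Definition aff (n N : nat) (X : T -> R) := exists (c : nat -> R) (th : R),
  X = fun x => lin (index_iota n N) c x + th.

Lemma aff_L2 n N X : aff n N X -> L2 X.
Proof.
by move=> [c [th ->]]; apply: L2D; [exact: L2_lin|exact: L2_cst].
Qed.

Lemma aff_cst n N th : aff n N (fun=> th).
Proof.
exists (fun=> 0), th; apply/funext => x.
by rewrite /lin big1 ?add0r// => i _; rewrite mul0r.
Qed.

Lemma affD n N X Y : aff n N X -> aff n N Y -> aff n N (fun x => X x + Y x).
Proof.
move=> [c [th ->]] [e [th' ->]]; exists (fun i => c i + e i), (th + th').
apply/funext => x; rewrite /lin addrACA; congr (_ + _).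
by rewrite -big_split/=; apply: eq_bigr => i _; rewrite mulrDl.
Qed.

Lemma affZ n N a X : aff n N X -> aff n N (fun x => a * X x).
Proof.
move=> [c [th ->]]; exists (fun i => a * c i), (a * th).
apply/funext => x; rewrite /lin mulrDr; congr (_ + _).
by rewrite mulr_sumr; apply: eq_bigr => i _; rewrite mulrA.
Qed.

Lemma affB n N X Y : aff n N X -> aff n N Y -> aff n N (fun x => X x - Y x).
Proof.
move=> aX aY; have := affD aX (affZ (-1) aY).
by under eq_fun do rewrite mulN1r.
Qed.

Lemma lin_mono (n n' N N' : nat) c : (n' <= n)%N -> (N <= N')%N ->
  lin (index_iota n N) c =
  lin (index_iota n' N') (fun i => if (n <= i < N)%N then c i else 0).
Proof.
move=> nn NN; apply/funext => x; rewrite /lin.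
rewrite (big_nat_widen _ _ _ _ _ NN) (big_nat_widenl _ _ _ _ _ nn) big_mkcond/=.
apply: eq_bigr => i _; rewrite andbC.
by case: ifP => //; rewrite mul0r.
Qed.

Lemma aff_mono (n n' N N' : nat) X : (n' <= n)%N -> (N <= N')%N ->
  aff n N X -> aff n' N' X.
Proof.
move=> nn NN [c [th ->]]; rewrite (lin_mono _ nn NN).
by exists (fun i => if (n <= i < N)%N then c i else 0), th.
Qed.

Lemma aff_Z n N i : (n <= i < N)%N -> aff n N (Z i).
Proof.
move=> /andP[ni iN]; apply: (@aff_mono i n i.+1 N) => //.
exists (fun=> 1), 0; apply/funext => x.
by rewrite /lin big_nat1 mul1r addr0.
Qed.

Lemma aff_recr (n N : nat) X : (n <= N)%N -> aff n N.+1 X ->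
  exists Y c, aff n N Y /\ X = fun x => Y x + c * Z N x.
Proof.
move=> nN [c [th ->]].
exists (fun x => lin (index_iota n N) c x + th), (c N); split.
  by exists c, th.
by apply/funext => x; rewrite /lin big_nat_recr//= addrAC.
Qed.

Lemma cov_orthogonal0 X Y : L2 X -> L2 Y -> cov X X = 0 -> cov X Y = 0.
Proof.
move=> X2 Y2 X0; have := cov_cauchy_schwarz X2 Y2.
by rewrite X0 mul0r real_exprn_even_le0 ?num_real//= => /eqP.
Qed.

(** Gram-Schmidt by induction on [N]: [g] and [Z N] are projected on the earlier span, and the
    projection of [g] is corrected along the residual [v] of [Z N]. For an empty block only
    constants remain, and 0 is a projection. *)
Lemma cov_projection (n N : nat) g : L2 g ->
  exists2 p, aff n N p & forall h, aff n N h -> cov h (fun x => g x - p x) = 0.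
Proof.
elim: N g => [|N IH] g g2.
  exists (fun=> 0); first exact: aff_cst.
  move=> h [c [th ->]]; rewrite (_ : index_iota n 0 = [::]); last first.
    by rewrite /index_iota sub0n.
  rewrite lin_nil; under eq_fun do rewrite add0r; exact: cov_cstl.
have [Nn|nN] := ltnP N n.
  exists (fun=> 0); first exact: aff_cst.
  move=> h [c [th ->]].
  rewrite (_ : index_iota n N.+1 = [::]); last first.
    by apply/eqP; rewrite -size_eq0 size_iota subn_eq0.
  rewrite lin_nil; under eq_fun do rewrite add0r; exact: cov_cstl.
have [p ap po] := IH g g2.
have [q aq qo] := IH (Z N) (Z2 N).
pose v x := Z N x - q x.
have up Y : aff n N Y -> aff n N.+1 Y by exact: aff_mono.
have av : aff n N.+1 v by apply: affB; [apply: aff_Z; rewrite nN/=|exact: up].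
have v2 := aff_L2 av; have p2 := aff_L2 ap; have q2 := aff_L2 aq.
(* If [cov v v = 0] the quotient is 0 by convention; [v] is then orthogonal to everything by
   Cauchy-Schwarz. *)
pose t := cov g v / cov v v.
have tv2 := L2Z t v2.
have gp2 := L2B g2 p2.
exists (fun x => p x + t * v x); first by apply: affD; [exact: up|exact: affZ].
have E : (fun x => g x - (p x + t * v x)) = (fun x => (g x - p x) - t * v x).
  by apply/funext => x; rewrite opprD addrA.
rewrite E.
have ho h : aff n N h -> cov h (fun x => (g x - p x) - t * v x) = 0.
  move=> ah; have h2 := aff_L2 ah.
  by rewrite covBr// covZr// po// qo// mulr0 subrr.
have vo : cov v (fun x => (g x - p x) - t * v x) = 0.
  rewrite covBr// covZr// covBr// (covC v p) qo// subr0 (covC v g) /t.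
  have [v0|v0] := eqVneq (cov v v) 0; last by rewrite divfK// subrr.
  by rewrite v0 mulr0 subr0 covC cov_orthogonal0.
move=> h /(aff_recr nN)[Y [c [aY ->]]].
have r2 := L2B gp2 tv2; have Y2 := aff_L2 aY.
have -> : (fun x => Y x + c * Z N x) = (fun x => (Y x + c * q x) + c * v x).
  by apply/funext => x; rewrite /v; ring.
have cq2 := L2Z c q2; have cv2 := L2Z c v2; have Ycq2 := L2D Y2 cq2.
by rewrite covDl// covDl// !covZl// vo !ho// !mulr0 !addr0.
Qed.

(** A constant adjusts the mean without affecting covariances; the cosine formula involves both. *)
Lemma aff_projection (n N : nat) g : L2 g ->
  exists p, [/\ aff n N p, mean p = mean g &
    forall h, aff n N h -> cov h (fun x => g x - p x) = 0].
Proof.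
move=> g2; have [p ap po] := cov_projection n N g2.
have p2 := aff_L2 ap.
exists (fun x => p x + (mean g - mean p)); split.
- by apply: affD => //; exact: aff_cst.
- rewrite meanD// ?mean_cst; first by ring.
  exact: L2_cst.
- move=> h ah; have h2 := aff_L2 ah.
  rewrite (_ : (fun x => _) = (fun x => (g x - p x) - (mean g - mean p))); last first.
    by apply/funext => x; ring.
  by rewrite covBr ?cov_cstr ?po ?subrr//; [exact: L2B|exact: L2_cst].
Qed.

(** * Cones and negative correlation *)

Hypothesis Zcov : forall i j, i <> j -> cov (Z i) (Z j) <= 0.

Definition cone (n N : nat) (X : T -> R) := exists2 c : nat -> R,
  (forall i, 0 <= c i) & X = lin (index_iota n N) c.

Lemma cone_L2 n N X : cone n N X -> L2 X.
Proof. by move=> [c _ ->]; exact: L2_lin. Qed.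

Lemma cone_mono (n n' N N' : nat) X : (n' <= n)%N -> (N <= N')%N ->
  cone n N X -> cone n' N' X.
Proof.
move=> nn NN [c c0 ->]; rewrite (lin_mono _ nn NN).
by exists (fun i => if (n <= i < N)%N then c i else 0) => // i; case: ifP.
Qed.

Lemma coneD n N X Y : cone n N X -> cone n N Y -> cone n N (fun x => X x + Y x).
Proof.
move=> [c c0 ->] [e e0 ->]; exists (fun i => c i + e i) => [i|].
  exact: addr_ge0.
apply/funext => x; rewrite /lin -big_split/=.
by apply: eq_bigr => i _; rewrite mulrDl.
Qed.

Lemma cone_cov_le0 (n N M : nat) X Y : cone n N X -> cone N M Y -> cov X Y <= 0.
Proof.
move=> [c c0 ->] [e e0 ->]; rewrite cov_lin.
rewrite big_seq; apply: sumr_le0 => i; rewrite mem_index_iota => /andP[_ iN].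
rewrite big_seq; apply: sumr_le0 => j; rewrite mem_index_iota => /andP[Nj _].
rewrite mulr_ge0_le0 ?mulr_ge0// Zcov// => ij.
by move: (leq_trans iN Nj); rewrite ij ltnn.
Qed.

(** Positive and negative parts of the coefficients. In [cov a b] the diagonal terms vanish, as one
    of the two parts of each coefficient is 0, and the others are nonpositive. *)
Lemma aff_cone_decomp n N p : aff n N p ->
  exists a b th, [/\ cone n N a, cone n N b, p = (fun x => (a x - b x) + th) &
    cov a b <= 0].
Proof.
move=> [c [th ->]].
exists (lin (index_iota n N) (fun i => Num.max (c i) 0)),
  (lin (index_iota n N) (fun i => Num.max (- c i) 0)), th; split.
- by exists (fun i => Num.max (c i) 0) => // i; rewrite le_max lexx orbT.
- by exists (fun i => Num.max (- c i) 0) => // i; rewrite le_max lexx orbT.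
- apply/funext => x; rewrite /lin -sumrB; congr (_ + _).
  apply: eq_bigr => i _; rewrite -mulrBl; congr (_ * _).
  by rewrite !maxEle oppr_le0; case: ltgtP => h; lra.
- rewrite cov_lin; apply: sumr_le0 => i _; apply: sumr_le0 => j _.
  have [->|/eqP ij] := eqVneq i j.
    rewrite (_ : Num.max _ _ * _ = 0) ?mul0r//.
    by rewrite !maxEle oppr_le0; case: ltgtP => h; rewrite ?mulr0 ?mul0r.
  rewrite mulr_ge0_le0 ?Zcov// mulr_ge0// le_max lexx orbT//.
Qed.

(* Vectors in cones on disjoint blocks make obtuse angles, so a sum of [K] of
   them has norm of order [sqrt K], whereas its scalar product with [g] would be
   of order [K]. *)
Lemma cone_cov_small g (G e : R) : L2 g -> 0 <= G -> 0 < e ->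
  exists n, forall N a, cone n N a -> cov a a <= G -> cov g a <= e.
Proof.
move=> g2 G0 e0; apply: contrapT => /forallNP H.
have {}H n : exists N a, [/\ cone n N a, cov a a <= G & e < cov g a].
  have /existsNP[N /existsNP[a /not_implyP[ca /not_implyP[aG /negP]]]] := H n.
  by rewrite -ltNge; exists N, a.
have sums K : exists N A, [/\ cone 0 N A, cov A A <= K%:R * G & K%:R * e <= cov g A].
  elim: K => [|K [N [A [cA AG gA]]]].
    exists 0, (fun=> 0); rewrite cov_cstl cov_cstr !mul0r; split => //.
    by exists (fun=> 0) => //; rewrite /index_iota subnn lin_nil.
  (* The new vector starts at [N], past all the indices used by [A]; the cross terms of the variance
     are thus nonpositive. *)
  have [M [a [ca aG ga]]] := H N.
  have A2 := cone_L2 cA; have a2 := cone_L2 ca.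
  exists (maxn N M), (fun x => A x + a x); split.
  - apply: coneD; first by apply: cone_mono cA; rewrite ?leq_maxl.
    by apply: cone_mono ca; rewrite ?leq_maxr.
  - rewrite covDl ?covDr//; last exact: L2D.
    have := cone_cov_le0 cA ca; rewrite (covC a A) -natr1; lra.
  - by rewrite covDr// -natr1; lra.
have := cov_ge0 g => gg0.
(* Cauchy-Schwarz gives [(K e)^2 <= cov g g * (K G)]; one factor [K] cancels, and a large [K] is
   contradictory. *)
have bound K : K%:R * e ^+ 2 <= cov g g * G.
  have [N [A [cA AG gA]]] := sums K.
  case: K AG gA => [|K] AG gA; first by rewrite mul0r mulr_ge0.
  have K0 : 0 < K.+1%:R :> R by rewrite ltr0n.
  have A2 := cone_L2 cA.
  have Ke0 : 0 <= K.+1%:R * e by rewrite mulr_ge0// ltW.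
  rewrite -(ler_pM2l K0) mulrA -expr2 -exprMn.
  apply: (@le_trans _ _ (cov g A ^+ 2)).
    by rewrite lerXn2r// nnegrE// (le_trans Ke0).
  apply: le_trans (cov_cauchy_schwarz g2 A2) _.
  by rewrite mulrCA ler_wpM2l.
have e20 : 0 < e ^+ 2 by rewrite exprn_gt0.
have := bound (Num.truncn (cov g g * G / e ^+ 2)).+1.
by rewrite -ler_pdivlMr// leNgt truncnS_gt.
Qed.

(** Orthogonality gives [cov p p = cov g p], at most [cov g g]. Writing [p = a - b + th] with
    [cov a b <= 0], both cone parts have variance at most [cov g g], so the cone estimate applies to
    [g] with [a] and to [- g] with [b]. The index [n] is uniform in [N]. *)
Lemma projection_cov_small g (e : R) : L2 g -> 0 < e ->
  exists n, forall N p, aff n N p -> cov p (fun x => g x - p x) = 0 ->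
  cov p p <= e.
Proof.
move=> g2 e0; have e2 : 0 < e / 2 by rewrite divr_gt0.
have g2' := L2Z (-1) g2.
have [n1 H1] := cone_cov_small g2 (cov_ge0 g) e2.
have [n2 H2] := cone_cov_small g2' (cov_ge0 g) e2.
exists (maxn n1 n2) => N p ap po.
have p2 := aff_L2 ap.
have pp : cov p p = cov g p.
  by move: po; rewrite covBr// => /eqP; rewrite subr_eq0 covC => /eqP.
have ppg : cov p p <= cov g g.
  have := cov_cauchy_schwarz g2 p2; rewrite -pp expr2.
  have := cov_ge0 p; rewrite le_eqVlt => /orP[/eqP <-|p0]; first by rewrite cov_ge0.
  by rewrite ler_pM2r.
have [a [b [th [ca cb pE ab]]]] := aff_cone_decomp ap.
have a2 := cone_L2 ca; have b2 := cone_L2 cb; have ab2 := L2B a2 b2.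
have th2 := L2_cst th.
have ppE : cov p p = cov a a + cov b b - 2 * cov a b.
  rewrite pE (covDl ab2 th2 (L2D ab2 th2)) cov_cstl (covDr ab2 th2 ab2) cov_cstr.
  by rewrite covBl// !covBr// (covC b a); ring.
have aG : cov a a <= cov g g by have := cov_ge0 b; lra.
have bG : cov b b <= cov g g by have := cov_ge0 a; lra.
have ga := H1 N a (cone_mono (leq_maxl _ _) (leqnn _) ca) aG.
have gb := H2 N b (cone_mono (leq_maxr _ _) (leqnn _) cb) bG.
rewrite covZl// in gb.
rewrite pp pE (covDr ab2 th2 g2) cov_cstr addr0 covBr//; lra.
Qed.

End covariance_form.

(** * Trigonometric polynomials in the process *)

Section trigonometric_polynomials.
Context d (T : measurableType d) (R : realType) (P : probability T R).
Variable Z : nat -> T -> R.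
Hypothesis Z2 : forall i, Z i \in Lfun P 2%:E.
Local Notation bm := (@bounded_measurable d T R).
Local Notation aff := (aff Z).
Local Notation cov := (cov P).
Local Notation mean := (mean P).

(* Affine functions of the process make the cosines absorb both the sines and
   the means of the [Z i]. *)
Inductive trig (n N : nat) : (T -> R) -> Prop :=
| trig_nil : trig n N (fun=> 0)
| trig_cons a X f : aff n N X -> trig n N f ->
    trig n N (fun x => a * cos (X x) + f x).

Lemma bm_cos n N X : aff n N X -> bm (fun x => cos (X x)).
Proof.
move=> aX; split; last by exists 1 => x; exact: cos_max.
apply: (measurableT_comp (continuous_measurable_fun (@continuous_cos R))).
exact: L2_measurable (aff_L2 Z2 aX).
Qed.

Lemma bm_trig n N f : trig n N f -> bm f.
Proof.
elim=> [|a X g aX _ IH]; first exact: bm_cst.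
by apply: bmD => //; apply: bmM; [exact: bm_cst|exact: bm_cos aX].
Qed.

Lemma trig_mono (n n' N N' : nat) f : (n' <= n)%N -> (N <= N')%N ->
  trig n N f -> trig n' N' f.
Proof.
move=> nn NN; elim=> [|a X g aX _ IH]; first exact: trig_nil.
by apply: trig_cons => //; exact: aff_mono aX.
Qed.

Lemma trigD n N f g : trig n N f -> trig n N g -> trig n N (fun x => f x + g x).
Proof.
move=> tf tg; elim: tf => [|a X h aX _ IH].
  by under eq_fun do rewrite add0r.
by under eq_fun do rewrite -addrA; exact: trig_cons.
Qed.

(** The product-to-sum formula, with [X + Y] and [X - Y] again affine. *)
Lemma trig_cosM n N a X f : aff n N X -> trig n N f ->
  trig n N (fun x => a * cos (X x) * f x).
Proof.
move=> aX; elim=> [|b Y h aY _ IH].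
  by under eq_fun do rewrite mulr0; exact: trig_nil.
rewrite (_ : (fun x => _) = fun x => (a * b / 2) * cos (X x + Y x) +
    ((a * b / 2) * cos (X x - Y x) + a * cos (X x) * h x)).
  by do 2 (apply: trig_cons; [exact: affD || exact: affB|]).
by apply/funext => x; rewrite cosD cosB; field.
Qed.

Lemma trigM n N f g : trig n N f -> trig n N g -> trig n N (fun x => f x * g x).
Proof.
move=> tf tg; elim: tf => [|a X h aX _ IH].
  by under eq_fun do rewrite mul0r; exact: trig_nil.
under eq_fun do rewrite mulrDl.
by apply: trigD => //; exact: trig_cosM.
Qed.

Definition tail_trig (n : nat) : set (T -> R) := [set f | exists N, trig n N f].

Lemma tail_trig_bm n f : tail_trig n f -> bm f.
Proof. by move=> [N]; exact: bm_trig. Qed.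

Lemma tail_trig_cos n N a X : aff n N X -> tail_trig n (fun x => a * cos (X x)).
Proof.
move=> aX; exists N; have := trig_cons a aX (trig_nil n N).
by under eq_fun do rewrite addr0.
Qed.

Lemma tail_trig_cst n c : tail_trig n (fun=> c).
Proof.
have := @tail_trig_cos n 0 c _ (aff_cst Z n 0 0).
by under eq_fun do rewrite cos0 mulr1.
Qed.

Lemma tail_trigD n f g : tail_trig n f -> tail_trig n g ->
  tail_trig n (fun x => f x + g x).
Proof.
move=> [N tf] [M tg]; exists (maxn N M).
by apply: trigD; [apply: trig_mono tf|apply: trig_mono tg];
  rewrite ?leq_maxl ?leq_maxr.
Qed.

Lemma tail_trigM n f g : tail_trig n f -> tail_trig n g ->
  tail_trig n (fun x => f x * g x).
Proof.
move=> [N tf] [M tg]; exists (maxn N M).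
by apply: trigM; [apply: trig_mono tf|apply: trig_mono tg];
  rewrite ?leq_maxl ?leq_maxr.
Qed.

(** Approximable events form a sigma-algebra that contains the generators; the sines required for
    this are cosines with phase shifted by [pi / 2]. *)
Lemma tail_event_approx n E :
  <<s \bigcup_(i in [set i | (n <= i)%N]) g_sigma_algebra_preimage (Z i) >> E ->
  approx_event P (tail_trig n) E.
Proof.
have salg := approx_event_sigma_algebra P (@tail_trig_bm n) (@tail_trig_cst n)
  (@tail_trigD n) (@tail_trigM n).
apply: (smallest_sub salg) => A [i /= ni [B mB <-]]; rewrite setTI.
suff QX a b : tail_trig n (fun x => sin (a * Z i x + b)).
  exact: (approx_event_preimage P (@tail_trig_bm n) (@tail_trig_cst n)
    (@tail_trigD n) (@tail_trigM n) QX mB).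
rewrite (_ : (fun x => _) = fun x => 1 * cos (a * Z i x + (b - pi / 2))).
  apply: (@tail_trig_cos _ i.+1).
  by apply: affD; [apply/affZ/aff_Z; rewrite ni/=|exact: aff_cst].
by apply/funext => x; rewrite mul1r addrA cosBpihalf.
Qed.

(** * Decorrelation of cosines from the tail *)

Hypothesis aff_cos : forall N X, aff 0 N X ->
  \int[P]_x cos (X x) = cos (mean X) * expR (- cov X X / 2).

Lemma aff_cosM N X Y : aff 0 N X -> aff 0 N Y ->
  \int[P]_x (cos (X x) * cos (Y x)) =
  (cos (mean X + mean Y) * expR (- cov X Y) +
   cos (mean X - mean Y) * expR (cov X Y)) / 2 *
  expR (- (cov X X + cov Y Y) / 2).
Proof.
move=> aX aY; have X2 := aff_L2 Z2 aX; have Y2 := aff_L2 Z2 aY.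
have aS := affD aX aY; have aD := affB aX aY.
have iS := bm_integrable P (bm_cos aS); have iD := bm_integrable P (bm_cos aD).
rewrite (_ : (fun x => _) = fun x => 1 / 2 *
    (cos (X x + Y x) + cos (X x - Y x))); last first.
  by apply/funext => x; rewrite cosD cosB; field.
rewrite RintegralZl//; last exact: (bm_integrable P (bmD (bm_cos aS) (bm_cos aD))).
rewrite RintegralD// !(aff_cos (N := N))// meanD// meanB//.
have S2 := L2D X2 Y2; have D2 := L2B X2 Y2.
rewrite (covDl X2 Y2 S2) !(covDr X2 Y2)// (covBl X2 Y2 D2) !(covBr X2 Y2)//.
rewrite (covC _ Y X).
have -> : - (cov X X + cov X Y + (cov X Y + cov Y Y)) / 2 =
  - cov X Y - (cov X X + cov Y Y) / 2 by field.
have -> : - (cov X X - cov X Y - (cov X Y - cov Y Y)) / 2 =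
  cov X Y - (cov X X + cov Y Y) / 2 by field.
by rewrite !expRD mulNr; field.
Qed.

(** As [g - p] is orthogonal to [X] and [p], replacing [g] by [p] keeps the mean and the covariance
    with [X], and lowers the variance by that of [g - p]. The resulting factor does not depend on
    [X], so it extends to trigonometric polynomials. *)
Lemma cos_projection n N N' X g p : (N <= N')%N ->
  aff n N X -> aff n N p -> aff 0 N' g -> mean p = mean g ->
  (forall h, aff n N h -> cov h (fun x => g x - p x) = 0) ->
  \int[P]_x (cos (X x) * cos (g x)) =
  expR (- cov (fun x => g x - p x) (fun x => g x - p x) / 2) *
  \int[P]_x (cos (X x) * cos (p x)).
Proof.
move=> NN aX ap ag pg po.
have X2 := aff_L2 Z2 aX; have p2 := aff_L2 Z2 ap; have g2 := aff_L2 Z2 ag.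
have r2 := L2B g2 p2.
rewrite (@aff_cosM N')//; last exact: aff_mono aX.
rewrite (@aff_cosM N'); [|exact: aff_mono aX|exact: aff_mono ap].
have Xg : cov X g = cov X p.
  by have := po _ aX; rewrite covBr// => /eqP; rewrite subr_eq0 => /eqP.
have pgp : cov p g = cov p p.
  by have := po _ ap; rewrite covBr// => /eqP; rewrite subr_eq0 => /eqP.
rewrite Xg pg (covBl g2 p2 r2) !(covBr g2 p2)// (covC _ g p) pgp.
by rewrite mulrCA -expRD; congr (_ * expR _); field.
Qed.

Lemma trig_projection n N N' q g p : (N <= N')%N ->
  trig n N q -> aff n N p -> aff 0 N' g -> mean p = mean g ->
  (forall h, aff n N h -> cov h (fun x => g x - p x) = 0) ->
  \int[P]_x (q x * cos (g x)) =
  expR (- cov (fun x => g x - p x) (fun x => g x - p x) / 2) *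
  \int[P]_x (q x * cos (p x)).
Proof.
move=> NN tq ap ag pg po; elim: tq => [|a X f aX tf IH].
  rewrite (_ : (fun x => _) = cst 0); last by apply/funext => x; rewrite mul0r.
  rewrite (_ : (fun x => 0 * cos (p x)) = cst 0); last by apply/funext => x; rewrite mul0r.
  by rewrite Rintegral_cst// !mul0r mulr0.
have bX := bm_cos aX; have bg := bm_cos ag; have bp := bm_cos ap.
have bf := bm_trig tf.
have i1 := bm_integrable P (bmM bX bg); have i2 := bm_integrable P (bmM bX bp).
have E (h : T -> R) : bm h -> \int[P]_x ((a * cos (X x) + f x) * h x) =
    a * \int[P]_x (cos (X x) * h x) + \int[P]_x (f x * h x).
  move=> bh; rewrite -RintegralZl//; last exact: (bm_integrable P (bmM bX bh)).
  rewrite -RintegralD//; last 2 first.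
  - exact: (bm_integrable P (bmM (bm_cst _ a) (bmM bX bh))).
  - exact: (bm_integrable P (bmM bf bh)).
  by apply: eq_Rintegral => x _; rewrite mulrDl mulrA.
rewrite !E// IH (cos_projection NN aX ap ag pg po) mulrDr; ring.
Qed.

(** With [e = exp (- v)] and [C = cos^2 m], the left side is [(1 - e^2) / 2 - C e (1 - e)], at most
    [1 - e], hence at most [v]. *)
Lemma variance_cos_le N p : aff 0 N p ->
  \int[P]_x ((cos (p x) - \int[P]_x cos (p x)) ^+ 2) <= cov p p.
Proof.
move=> ap; have p2 := aff_L2 Z2 ap.
set mu := \int[P]_x cos (p x).
have b1 := bm_cos ap; have b2 := bmM b1 b1.
have i1 := bm_integrable P b1; have i2 := bm_integrable P b2.
have muE := aff_cos ap; rewrite -/mu in muE.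
have E2 : \int[P]_x ((cos (p x) - mu) ^+ 2) = \int[P]_x (cos (p x) * cos (p x)) - mu ^+ 2.
  rewrite (_ : (fun x => _) = fun x => cos (p x) * cos (p x) +
    (- (2 * mu) * cos (p x) + mu ^+ 2)); last first.
    by apply/funext => x; ring.
  have b3 := bmM (bm_cst T (- (2 * mu))) b1.
  have b4 := bmD b3 (bm_cst T (mu ^+ 2)).
  rewrite RintegralD//; last exact: (bm_integrable P b4).
  rewrite RintegralD//; [|exact: (bm_integrable P b3)|exact: finite_measure_integrable_cst].
  rewrite RintegralZl// Rintegral_cst// [X in fine X](probability_setT P) -/mu /=; ring.
rewrite E2 (aff_cosM ap ap) muE.
set v := cov p p; set m := mean p.
have v0 : 0 <= v := cov_ge0 P p.
set e := expR (- v).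
have eE : expR (- (v + v) / 2) = e by congr expR; field.
have e2E : expR (- v / 2) ^+ 2 = e by rewrite expr2 -expRD; congr expR; field.
have ev : expR v * e = 1 by rewrite -expRD subrr expR0.
have e_ge : 1 - v <= e := expR_ge1Dx (- v).
have e_le : e <= 1 by rewrite -[leRHS]expR0 ler_expR oppr_le0.
have e_ge0 : 0 <= e := expR_ge0 (- v).
rewrite subrr cos0 mul1r cosD -!expr2 sin2cos2 exprMn eE e2E.
set C := cos m ^+ 2; have C0 : 0 <= C := sqr_ge0 _.
have -> : ((C - (1 - C)) * e + expR v) / 2 * e - C * e =
  ((2 * C - 1) * e ^+ 2 + expR v * e) / 2 - C * e by field.
have e1 : 0 <= 1 - e by rewrite subr_ge0.
have := mulr_ge0 C0 (mulr_ge0 e_ge0 e1).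
by rewrite ev; nra.
Qed.

Hypothesis Zcov : forall i j, i <> j -> cov (Z i) (Z j) <= 0.

(** Up to a factor [k <= 1], [g] may be replaced by its projection [p] on the block of [q];
    Cauchy-Schwarz and the smallness of the variance of [cos p] conclude. The index [n] does not
    depend on [q]. *)
Lemma trig_cos_decorrelation N g (e : R) : aff 0 N g -> 0 < e ->
  exists n, forall q, tail_trig n q ->
    (\int[P]_x (q x * (cos (g x) - \int[P]_x cos (g x)))) ^+ 2 <=
    \int[P]_x (q x ^+ 2) * e.
Proof.
move=> ag e0; have g2 := aff_L2 Z2 ag.
have [n small] := projection_cov_small Z2 Zcov g2 e0.
exists n => q [M tq].
have [p [ap pg po]] := aff_projection Z2 n M g2.
have {}small := small M p ap (po _ ap).
pose K := maxn N M.
have agK : aff 0 K g by apply: aff_mono ag; rewrite ?leq_maxl.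
have apK : aff 0 K p by apply: aff_mono ap; rewrite ?leq_maxr.
have MK : (M <= K)%N by rewrite leq_maxr.
set k := expR (- cov (fun x => g x - p x) (fun x => g x - p x) / 2).
have bq := bm_trig tq; have bg := bm_cos ag; have bp := bm_cos ap.
have iq := bm_integrable P bq.
have center (h : T -> R) c : bm h ->
    \int[P]_x (q x * (h x - c)) = \int[P]_x (q x * h x) - \int[P]_x q x * c.
  move=> bh; rewrite -RintegralZr// -RintegralB//; last 2 first.
  - exact: (bm_integrable P (bmM bq bh)).
  - exact: (bm_integrable P (bmM bq (bm_cst T c))).
  by apply: eq_Rintegral => x _; rewrite mulrBr.
(* The constant 0, of cosine 1, plays the part of [X]: the means carry the same factor [k]. *)
have gk : \int[P]_x cos (g x) = k * \int[P]_x cos (p x).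
  have := @cos_projection n M K _ g p MK (aff_cst Z n M 0) ap agK pg po.
  under eq_Rintegral do rewrite cos0 mul1r.
  by under [X in _ = _ * X]eq_Rintegral do rewrite cos0 mul1r.
rewrite center// (trig_projection MK tq ap agK pg po) gk -/k mulrCA -mulrBr -center//.
rewrite exprMn.
have bc := bmB bp (bm_cst T (\int[P]_x cos (p x))).
apply: (@le_trans _ _ (\int[P]_x (q x ^+ 2) * cov p p)); last first.
  by rewrite ler_wpM2l//; apply: Rintegral_ge0 => x _; exact: sqr_ge0.
apply: (@le_trans _ _ ((\int[P]_x (q x * (cos (p x) - \int[P]_x cos (p x)))) ^+ 2)).
  rewrite ler_piMl ?sqr_ge0//; apply: exprn_ile1; first exact: expR_ge0.
  by rewrite -[leRHS]expR0 ler_expR mulNr oppr_le0 divr_ge0// cov_ge0.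
apply: le_trans (Rintegral_cauchy_schwarz P bq bc) _.
rewrite ler_wpM2l//; last exact: variance_cos_le apK.
by apply: Rintegral_ge0 => x _; exact: sqr_ge0.
Qed.

Lemma tail_event_cos_uncorrelated N g E : aff 0 N g ->
  (forall n, approx_event P (tail_trig n) E) ->
  \int[P]_x (\1_E x * (cos (g x) - \int[P]_x cos (g x))) = 0.
Proof.
move=> ag aE; have [mE _] := aE 0.
have bE := @bm_indic _ _ R _ mE.
set c := \int[P]_x cos (g x); have bc := bmB (bm_cos ag) (bm_cst T c).
set I := \int[P]_x _.
set V := \int[P]_x ((cos (g x) - c) ^+ 2).
have V0 : 0 <= V by apply: Rintegral_ge0 => x _; exact: sqr_ge0.
set W := \int[P]_x ((\1_E x : R) ^+ 2).
have W0 : 0 <= W by apply: Rintegral_ge0 => x _; exact: sqr_ge0.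
(* The index [n] is fixed by [e] first, then [q] approximates the event from indices at least [n].
   The split [I = A + B] has [A^2 <= e V] and [B^2 <= (2 e + 2 W) e]; [e <= 1] absorbs the square of
   [e]. *)
have bound e : 0 < e -> e <= 1 -> I ^+ 2 <= e * (2 * V + 4 * W + 4).
  move=> e0 e1; have [n decor] := trig_cos_decorrelation ag e0.
  have [_ [_ /(_ e e0)[q tq qE]]] := aE n.
  have bq := tail_trig_bm tq; have bEq := bmB bE bq; have bqE := bmB bq bE.
  have IE : I = \int[P]_x ((\1_E x - q x) * (cos (g x) - c)) +
                \int[P]_x (q x * (cos (g x) - c)).
    rewrite -RintegralD//; last 2 first.
    - exact: (bm_integrable P (bmM bEq bc)).
    - exact: (bm_integrable P (bmM bq bc)).
    by apply: eq_Rintegral => x _; ring.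
  have q2 : \int[P]_x (q x ^+ 2) <= 2 * e + 2 * W.
    rewrite (_ : (fun x => q x ^+ 2) = fun x => ((q x - \1_E x) + \1_E x) ^+ 2); last first.
      by apply/funext => x; rewrite subrK.
    apply: le_trans (Rintegral_sqrD_le P bqE bE) _; rewrite lerD2r ler_wpM2l//.
    apply: le_trans qE; rewrite le_eqVlt; apply/orP; left; apply/eqP.
    by apply: eq_Rintegral => x _; ring.
  have s1 := Rintegral_cauchy_schwarz P bEq bc; rewrite -/V in s1.
  have s2 := decor q tq; rewrite -/c in s2.
  set A := \int[P]_x ((\1_E x - q x) * _) in IE s1.
  set B := \int[P]_x (q x * _) in IE s2.
  have s3 := ler_wpM2r V0 qE.
  have s4 := ler_wpM2r (ltW e0) q2.
  rewrite IE; have := sqr_ge0 (A - B); nra.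
apply/eqP; rewrite -sqrf_eq0 eq_le sqr_ge0 andbT leNgt; apply/negP => I0.
set D := 2 * V + 4 * W + 4 in bound.
have D0 : 0 < D by rewrite /D; lra.
(* This choice would give [I^2 <= I^2 / 2]. *)
set e := Num.min 1 (I ^+ 2 / (2 * D)).
have D2 : 0 < 2 * D by rewrite mulr_gt0.
have e0 : 0 < e by rewrite lt_min ltr01 divr_gt0.
have e1 : e <= 1 by rewrite ge_min lexx.
have := bound e e0 e1.
have : e * D <= I ^+ 2 / 2.
  apply: (@le_trans _ _ (I ^+ 2 / (2 * D) * D)).
    by rewrite ler_wpM2r ?(ltW D0)// ge_min lexx orbT.
  by rewrite le_eqVlt; apply/orP; left; apply/eqP; field; rewrite gt_eqF.
lra.
Qed.

Lemma tail_event_uncorrelated q E : tail_trig 0 q ->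
  (forall n, approx_event P (tail_trig n) E) ->
  \int[P]_x ((\1_E x - fine (P E)) * q x) = 0.
Proof.
move=> [N tq] aE; have [mE _] := aE 0.
have bE := @bm_indic _ _ R _ mE; have bEc := bmB bE (bm_cst T (fine (P E))).
have PE : \int[P]_x (\1_E x : R) = fine (P E).
  by rewrite /Rintegral integral_indic// setIT.
elim: tq => [|a X f aX tf IH].
  rewrite (_ : (fun x => _) = cst 0); last by apply/funext => x; rewrite mulr0.
  by rewrite Rintegral_cst// mul0r.
have bX := bm_cos aX; have bf := bm_trig tf.
have i1 := bm_integrable P (bmM bEc bX); have i2 := bm_integrable P (bmM bEc bf).
rewrite (_ : (fun x => _) = fun x => a * ((\1_E x - fine (P E)) * cos (X x)) +
   (\1_E x - fine (P E)) * f x); last by apply/funext => x; ring.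
rewrite RintegralD//; last exact: (bm_integrable P (bmM (bm_cst _ a) (bmM bEc bX))).
rewrite RintegralZl// IH addr0.
have := tail_event_cos_uncorrelated aX aE.
set c := \int[P]_x cos (X x) => H.
have b1 := bmM bE (bmB bX (bm_cst T c)); have i3 := bm_integrable P b1.
have i4 := bm_integrable P bE; have i5 := bm_integrable P bX.
(* The centring moves from the event to the cosine; the two correction terms have the same integral
   [c * P E]. *)
rewrite (_ : (fun x => _) = fun x => \1_E x * (cos (X x) - c) +
   (c * \1_E x - fine (P E) * cos (X x))); last by apply/funext => x; ring.
have b2 := bmM (bm_cst T c) bE; have b3 := bmM (bm_cst T (fine (P E))) bX.
have i6 := bm_integrable P b2; have i7 := bm_integrable P b3.
rewrite RintegralD//; last exact: (bm_integrable P (bmB b2 b3)).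
rewrite RintegralB// !RintegralZl// H PE -/c; ring.
Qed.

(** The event is approximated by polynomials [q] uncorrelated with it, so its variance [u - u^2] is
    0. *)
Lemma tail_event_trivial E : (forall n, approx_event P (tail_trig n) E) ->
  P E = 0%E \/ P E = 1%E.
Proof.
move=> aE; have [mE [_ aE0]] := aE 0.
have bE := @bm_indic _ _ R _ mE; have bEc := bmB bE (bm_cst T (fine (P E))).
have PE : \int[P]_x (\1_E x : R) = fine (P E).
  by rewrite /Rintegral integral_indic// setIT.
set u := fine (P E) in bEc PE *.
have PEu : P E = u%:E by rewrite fineK// fin_num_measure.
have varE : \int[P]_x ((\1_E x - u) * \1_E x) = u - u ^+ 2.
  rewrite (_ : (fun x => _) = fun x => (1 - u) * \1_E x); last first.
    by apply/funext => x; rewrite indicE; case: (x \in E); rewrite /=; ring.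
  by rewrite RintegralZl ?PE//; [ring|exact: (bm_integrable P bE)].
set V := \int[P]_x ((\1_E x - u) ^+ 2).
have V0 : 0 <= V by apply: Rintegral_ge0 => x _; exact: sqr_ge0.
have bound e : 0 < e -> (u - u ^+ 2) ^+ 2 <= V * e.
  move=> e0; have [q tq qE] := aE0 e e0.
  have bq := tail_trig_bm tq; have bEq := bmB bE bq.
  have <- : \int[P]_x ((\1_E x - u) * (\1_E x - q x)) = u - u ^+ 2.
    rewrite -varE -[RHS]subr0 -(tail_event_uncorrelated tq aE) -RintegralB//; last 2 first.
    - exact: (bm_integrable P (bmM bEc bE)).
    - exact: (bm_integrable P (bmM bEc bq)).
    by apply: eq_Rintegral => x _; rewrite mulrBr.
  apply: le_trans (Rintegral_cauchy_schwarz P bEc bEq) _.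
  by rewrite ler_wpM2l.
have : (u - u ^+ 2) ^+ 2 <= 0.
  rewrite leNgt; apply/negP; set y := _ ^+ 2 => y0.
  have V1 : 0 < V + 1 by lra.
  have := bound (y / (2 * (V + 1))) (divr_gt0 y0 (mulr_gt0 (ltr0n _ 2) V1)).
  rewrite -/y mulrA ler_pdivlMr ?mulr_gt0//; nra.
rewrite real_exprn_even_le0 ?num_real//= => /eqP.
rewrite (_ : u - u ^+ 2 = u * (1 - u)); last by ring.
move=> /eqP; rewrite mulf_eq0 subr_eq0 PEu => /orP[/eqP ->|/eqP <-]; by [left|right].
Qed.

End trigonometric_polynomials.

(** * Application to the Gaussian process *)

Lemma gaussian_process_lin_cos d (T : measurableType d) (R : realType)
    (P : probability T R) (Z : nat -> {RV P >-> R}) (N : nat) (c : nat -> R)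
    (th : R) :
  gaussian_process Z -> let X := lin (fun i => Z i : T -> R) (index_iota 0 N) c in
  X \in Lfun P 2%:E /\
  \int[P]_x cos (X x + th) = cos (mean P X + th) * expR (- cov P X X / 2).
Proof.
move=> hZ X; apply: is_gaussian_cos.
  by apply: measurable_sum => i; apply: measurable_funM => //.
have -> : X = fun x => \sum_(i < N) c i * Z i x.
  by apply/funext => x; rewrite /X /lin big_mkord.
exact: (hZ N (fun i => i : nat) val_inj (fun i => c i)).
Qed.

Theorem theorem3p1 (d : measure_display) (T : measurableType d) (R : realType)
    (P : probability T R) (Z : nat -> {RV P >-> R})
    (hZ : gaussian_process Z)
    (hcov : forall i j : nat, i <> j -> (covariance P (Z i) (Z j) <= 0)%E)
    (E : set T) (hE : tail_sigma_algebra Z E) :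
  P E = 0%E \/ P E = 1%E.
Proof.
pose Y i : T -> R := Z i.
have Y2 i : Y i \in Lfun P 2%:E.
  (* A single variable is the combination with coefficients 0 except 1 at [i]. *)
  have [X2 _] := gaussian_process_lin_cos i.+1 (fun j => (j == i)%:R) 0 hZ.
  rewrite (_ : Y i = lin (fun i => Z i : T -> R) (index_iota 0 i.+1)
    (fun j => (j == i)%:R))//; apply/funext => x.
  rewrite /lin big_nat_recr//= eqxx mul1r big_nat big1 ?add0r// => j /andP[_ ji].
  by rewrite (ltn_eqF ji) mul0r.
(* The constant term shifts the mean and leaves the variance unchanged. *)
have affY N X : aff Y 0 N X ->
    \int[P]_x cos (X x) = cos (mean P X) * expR (- cov P X X / 2).
  move=> [c [th ->]]; have [L2 ->] := gaussian_process_lin_cos N c th hZ.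
  have t2 := L2_cst P th; have s2 := L2D L2 t2.
  rewrite meanD// mean_cst (covDl L2 t2 s2) cov_cstl addr0.
  by rewrite (covDr L2 t2 L2) cov_cstr addr0.
have Ycov i j : i <> j -> cov P (Y i) (Y j) <= 0.
  by move=> ij; rewrite /cov fine_le0//; exact: hcov.
apply: (tail_event_trivial Y2 affY Ycov) => n.
exact: (tail_event_approx Y2) (hE n I).
Qed.
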